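(* Let $t_0,t_1>0$ be real numbers and let $\Psi:\mathbb N\to[1,\infty)$ be a function such that the number $B$ defined by $\log B=\liminf_{n\to\infty}\frac{\log\Psi(n)}{n}$ satisfies $1<B<\infty$. Let $$\mathcal E_{(t_0,t_1)}(\Psi)=\Big\{x\in[0,1):\ a_n(x)^{t_0}a_{n+1}(x)^{t_1}\ge\Psi(n)\ \text{for infinitely many } n\in\mathbb N\Big\}.$$ Then $$\dim_{\mathrm H}\mathcal E_{(t_0,t_1)}(\Psi)=\inf\big\{s\ge0:\ P\big(T,-s\log|T'|-f_{t_0,t_1}(s)\log B\big)\le0\big\},$$ where $\dim_{\mathrm H}$ is Hausdorff dimension and $$f_{t_0,t_1}(s)=\frac{s^2}{t_0t_1\cdot\max\left\{\frac{s}{t_1}+\frac{1-s}{t_0},\ \frac{s}{t_0}\right\}}.$$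
   Context: $\mathbb N=\{1,2,3,\dots\}$. $T:[0,1)\to[0,1)$ is the Gauss map, $T(0)=0$, $T(x)=1/x \bmod 1$ for $x\in(0,1)$, so $|T'(x)|=x^{-2}$. For irrational $x\in[0,1)$, $a_n(x)=\lfloor 1/T^{n-1}(x)\rfloor$, $n\ge1$, are the partial quotients of its regular continued fraction $x=[a_1(x),a_2(x),\dots]$. Rational $x$ (a countable set) are irrelevant to the statement. For a potential $\phi:[0,1)\to\mathbb R$ (defined at least on the irrationals) the pressure is $$P(T,\phi)=\lim_{n\to\infty}\frac1n\log\sum_{(a_1,\dots,a_n)\in\mathbb N^n}\ \sup_{x}\ e^{S_n\phi([a_1,\dots,a_{n-1},a_n+x])}\in(-\infty,+\infty],$$ where the supremum is over irrational $x\in[0,1)$, $[a_1,\dots,a_{n-1},a_n+x]$ is the point with continued fraction digits $a_1,\dots,a_n$ followed by those of $x$, and $S_n\phi(y)=\phi(y)+\phi(Ty)+\cdots+\phi(T^{n-1}y)$. The limit exists for the potentials considered. The function $f_{t_0,t_1}$ is set equal to $0$ at $s=0$ where needed (this agrees with the formula). *)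

(* Defs.v *)
From HB Require Import structures.
From mathcomp Require Import all_boot all_order all_algebra.
From mathcomp Require Import all_classical all_reals all_analysis.

Set Implicit Arguments.
Unset Strict Implicit.
Unset Printing Implicit Defensive.
Import Order.TTheory GRing.Theory Num.Theory.
Import numFieldNormedType.Exports.

Local Open Scope classical_set_scope.
Local Open Scope ring_scope.

Section ContinuedFractions.
Context {R : realType}.

(* Only the values on [0, 1[ matter. *)
Definition gauss (x : R) : R :=
  if x == 0 then 0 else x^-1 - (Num.floor x^-1)%:~R.

(* a_n(x), meaningful for n >= 1 and x irrational in [0, 1[. *)
Definition partial_quotient (n : nat) (x : R) : int :=
  Num.floor (iter n.-1 gauss x)^-1.

Definition irr01 : set R := [set x | 0 <= x < 1] `&` @irrational R.

(* [a_1, ..., a_{n-1}, a_n + x] = 1 / (a_1 + 1 / (... + 1 / (a_n + x))) *)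
Definition cfrac (a : seq nat) (x : R) : R :=
  foldr (fun k y => (k%:R + y)^-1) x a.

Definition birkhoff_sum (phi : R -> R) (n : nat) (y : R) : R :=
  \sum_(k < n) phi (iter k gauss y).

Definition pressure_sum (phi : R -> R) (n : nat) : \bar R :=
  \esum_(a in [set a : n.-tuple nat | forall i, (0 < tnth a i)%N])
    ereal_sup [set (expR (birkhoff_sum phi n (cfrac a x)))%:E | x in irr01].

(* The sums may be +oo, hence the extended logarithm and limit. *)
Definition pressure (phi : R -> R) : \bar R :=
  limn (fun n : nat => (n%:R^-1)%:E * lne (pressure_sum phi n))%E.

(* At s = 0 the formula itself gives 0, as the maximum is then t0^-1. *)
Definition f_t (t0 t1 s : R) : R :=
  s ^+ 2 / (t0 * t1 * Num.max (s / t1 + (1 - s) / t0) (s / t0)).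

(* Partial quotients are only defined at irrational points. *)
Definition E_t (t0 t1 : R) (Psi : nat -> R) : set R :=
  [set x | irr01 x /\
    infinite_set [set n : nat | (0 < n)%N /\
      Psi n <= (partial_quotient n x)%:~R `^ t0 *
               (partial_quotient n.+1 x)%:~R `^ t1]].

End ContinuedFractions.

Section Hausdorff.
Context {R : realType}.
Local Open Scope ereal_scope.

Definition diam (U : set R) : \bar R :=
  ereal_sup [set `|p.1 - p.2|%:E | p in U `*` U].

(* |U|^s, with the conventions |set0|^0 = 0 and |{x}|^0 = 1. *)
Definition diam_pow (s : R) (U : set R) : \bar R :=
  if U == set0 then 0 else diam U `^ s.

Definition hausdorff_content (s delta : R) (E : set R) : \bar R :=
  ereal_inf [set \sum_(0 <= i <oo) diam_pow s (U i) |
    U in [set U : (set R)^nat |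
      E `<=` \bigcup_i U i /\ forall i, diam (U i) <= delta%:E]].

Definition hausdorff_measure (s : R) (E : set R) : \bar R :=
  ereal_sup [set hausdorff_content s delta E |
    delta in [set delta : R | (0 < delta)%R]].

Definition hausdorff_dim (E : set R) : \bar R :=
  ereal_inf [set s%:E |
    s in [set s : R | (0 <= s)%R /\ hausdorff_measure s E = 0]].

End Hausdorff.

(* Main.v *)
Require Import Defs.
From mathcomp Require Import all_boot all_order all_algebra.
From mathcomp Require Import all_classical all_reals all_analysis.
From mathcomp Require Import ring lra zify.

Set Implicit Arguments.
Unset Strict Implicit.
Unset Printing Implicit Defensive.
Import Order.TTheory GRing.Theory Num.Theory.
Import numFieldNormedType.Exports.

Local Open Scope classical_set_scope.
Local Open Scope ring_scope.

(** For a finite word [u] let q(u) be its continuant.  Up to factors 2, q is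
    multiplicative under concatenation and the points whose expansion starts
    with [u] form an interval of length q(u)^-2.  Hence the sums
    S_n(s) = sum of q(u)^(-2s) over the words of length n are almost
    multiplicative, and the pressure of [- s log |T'| - c] is P(s) - c with
    e^(n P(s)) <= S_n(s) <= 4^s e^(n P(s)).

    Upper bound.  Let b < log B.  A point of the set has, for infinitely many n,
    either a_n >= A^n or a_n < A^n and a_(n+1) >= (e^(n b) / a_n^t0)^(1/t1).
    Covering the corresponding pieces of each cylinder of level n - 1 costs
    about S_(n-1)(s) (A^-s + e^(-b s / t1) max(1, A^(1 - 2 s + s t0 / t1)))^n;
    with A = e^(b f(s) / s) both terms are at most e^(-b f(s)).

    Lower bound.  If P(s) > f(s) log B, a finite set W of words of one length l
    already has sum of q(w)^(-2s) much larger than B^(f(s) l).  Consider the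
    points whose digits are made of words of W, except that at very sparse
    times n with Psi(n) <= e^(n b), b > log B, the digits a_n and a_(n+1) range
    over [M, 3M[ and [M', 3M'[ with log M = alpha b n and
    t0 log M + t1 log M' = b n.  Give a word of W a mass proportional to
    q(w)^(-2s), and the digits in the sparse positions equal masses.  Given a
    cover with a small sum of diameters to the power s, one can descend in this
    tree keeping the cost of the pieces that meet the current cylinder below the
    mass of that cylinder; since the masses tend to 0, the limit point is not
    covered. *)

(** * Continuants *)

Definition word : pred (seq nat) := all (fun k => 0 < k)%N.

Section Continuants.
Context {R : realType}.
Implicit Types (x y t : R) (u v : seq nat) (k n : nat).

(* The square of [den u t] is the inverse of the derivative of [cfrac u] at [t];
   [den u 0] is the usual continuant q_n of the word [u]. *)
Fixpoint den u t : R :=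
  if u is k :: v then (k%:R + cfrac v t) * den v t else 1.

Definition cont u : R := den u 0.

Lemma cfrac_cat u v t : cfrac (u ++ v) t = cfrac u (cfrac v t).
Proof. by rewrite /cfrac foldr_cat. Qed.

Lemma den_cat u v t : den (u ++ v) t = den u (cfrac v t) * den v t.
Proof. by elim: u => [|k u IH] /=; rewrite ?mul1r// cfrac_cat IH mulrA. Qed.

Lemma cfrac_itv u t : word u -> 0 <= t <= 1 -> 0 <= cfrac u t <= 1.
Proof.
elim: u => [//|k u IH] /= /andP[k0 wu] t01; have /andP[c0 c1] := IH wu t01.
have k1 : 1 <= k%:R :> R by rewrite ler1n.
rewrite invr_ge0 addr_ge0//= invf_le1; lra.
Qed.

Lemma den_gt0 u t : word u -> 0 <= t <= 1 -> 0 < den u t.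
Proof.
elim: u => [//|k u IH] /= /andP[k0 wu] t01; have /andP[c0 c1] := cfrac_itv wu t01.
have k1 : 1 <= k%:R :> R by rewrite ler1n.
by rewrite mulr_gt0// ?IH//; lra.
Qed.

(** [cfrac u] is a Moebius map of determinant 1 or -1 with denominator [den u], hence an exact
    identity. *)
Lemma cfracB u x y : word u -> 0 <= x <= 1 -> 0 <= y <= 1 ->
  `|cfrac u x - cfrac u y| = `|x - y| / (den u x * den u y).
Proof.
move=> wu x01 y01; elim: u wu => [_|k u IH] /=; first by rewrite mul1r divr1.
move=> /andP[k0 wu]; have /andP[a0 _] := cfrac_itv wu x01.
have /andP[b0 _] := cfrac_itv wu y01.
have k1 : 1 <= k%:R :> R by rewrite ler1n.
have dx := den_gt0 wu x01; have dy := den_gt0 wu y01.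
have -> : (k%:R + cfrac u x)^-1 - (k%:R + cfrac u y)^-1 =
   (cfrac u y - cfrac u x) / ((k%:R + cfrac u x) * (k%:R + cfrac u y)).
  by field; rewrite !gt_eqF//; lra.
have K : 0 <= (k%:R + cfrac u x) * (k%:R + cfrac u y).
  by rewrite mulr_ge0//; lra.
rewrite normrM distrC IH// normfV (ger0_norm K).
by field; rewrite !gt_eqF//; lra.
Qed.

(* The second and third conditions make the bound [q' <= q] on the
   coefficients of [den u t = q + q' t] inductive. *)
Lemma den_affine u : word u ->
  exists q q' p p' : R, [/\ 0 <= q', q' <= q, p' + q' <= p + q,
    0 <= p' & forall t, 0 <= t <= 1 ->
      den u t = q + q' * t /\ cfrac u t * den u t = p + p' * t].
Proof.
elim: u => [_|k u IH] /=.
  by exists 1, 0, 0, 1; split => //; try lra; move=> t _; split; ring.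
move=> /andP[k0 wu]; have [q [q' [p [p' [q0 qq pq p0 H]]]]] := IH wu.
have k1 : 1 <= k%:R :> R by rewrite ler1n.
exists (k%:R * q + p), (k%:R * q' + p'), q, q'; split => //.
- by rewrite addr_ge0// mulr_ge0//; lra.
- by nra.
- by nra.
move=> t t01; have [dE cE] := H t t01.
have /andP[c0 _] := cfrac_itv wu t01.
split; first by rewrite mulrDl cE dE; ring.
by rewrite mulKf ?dE// gt_eqF//; lra.
Qed.

(** Bounded distortion with constant 2, since [den u] is q + q' t with 0 <= q' <= q. *)
Lemma den_bounds u t : word u -> 0 <= t <= 1 -> cont u <= den u t <= 2 * cont u.
Proof.
move=> wu t01; have [q [q' [p [p' [q0 qq pq p0 H]]]]] := den_affine wu.
have [->] := H t t01; have [|] := H 0; first by rewrite lexx ler01.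
rewrite /cont => -> _ _; nra.
Qed.

Lemma cont_gt0 u : word u -> 0 < cont u.
Proof. by move=> wu; rewrite den_gt0// lexx ler01. Qed.

(** By the chain rule [den_cat], the only error is the variation of [den u] over [0, 1]. *)
Lemma cont_cat u v : word u -> word v ->
  cont u * cont v <= cont (u ++ v) <= 2 * (cont u * cont v).
Proof.
move=> wu wv; have v01 : 0 <= (cfrac v 0 : R) <= 1.
  by rewrite cfrac_itv// lexx ler01.
have /andP[h1 h2] := den_bounds wu v01; have := cont_gt0 wv.
have -> : cont (u ++ v) = den u (cfrac v 0) * cont v by rewrite /cont den_cat.
by move=> v0; rewrite !(mulrA 2) !ler_pM2r// h1.
Qed.

Lemma cont1 k : cont [:: k] = k%:R.
Proof. by rewrite /cont /= addr0 mulr1. Qed.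

Lemma word_cat u v : word (u ++ v) = word u && word v.
Proof. exact: all_cat. Qed.

Lemma cont_ge1 u : word u -> 1 <= cont u.
Proof.
elim: u => [//|k u IH] /andP[k0 wu].
have /andP[+ _] := @cont_cat [:: k] u (introT andP (conj k0 isT)) wu.
rewrite cont1 /=.
have k1 : 1 <= k%:R :> R by rewrite ler1n.
by have := IH wu; nra.
Qed.

(** Letters are removed in pairs: the continuant of two letters k, l is k l + 1 >= 2. *)
Lemma cont_ge_pow u : word u -> 2 ^+ (size u)./2 <= cont u.
Proof.
have [n] := ubnP (size u); elim: n u => // n IH [|k [|l u]] //=.
- by move=> _ wu; exact: cont_ge1.
- rewrite !ltnS => sn /and3P[k0 l0 wu].
  have wkl : word [:: k; l] by rewrite /= k0 l0.
  have /andP[+ _] := cont_cat wkl wu; rewrite /=.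
  have -> : cont [:: k; l] = k%:R * l%:R + 1.
    have ? : 1 <= l%:R :> R by rewrite ler1n.
    by rewrite /cont /= addr0 mulr1 mulrDl mulVf// gt_eqF//; lra.
  have k1 : 1 <= k%:R :> R by rewrite ler1n.
  have l1 : 1 <= l%:R :> R by rewrite ler1n.
  have kl1 : 1 <= k%:R * l%:R :> R by rewrite mulr_ege1.
  have := IH u (leqW sn) wu; rewrite exprS => + h2; have := cont_gt0 wu.
  have : 0 < 2 ^+ (size u)./2 :> R by rewrite exprn_gt0.
  set c := cont u in h2 *; set kl := _ * _ in kl1 h2; set b := _ ^+ _.
  move=> b0 c0 bc; apply: le_trans h2; nra.
Qed.

Lemma cfrac_dist_le u x y : word u -> 0 <= x <= 1 -> 0 <= y <= 1 ->
  `|cfrac u x - cfrac u y| <= `|x - y| / cont u ^+ 2.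
Proof.
move=> wu x01 y01; rewrite cfracB// ler_wpM2l//.
have /andP[h1 _] := den_bounds wu x01; have /andP[h2 _] := den_bounds wu y01.
have := cont_gt0 wu => h; rewrite lef_pV2 ?posrE; last 2 first.
- by rewrite mulr_gt0//; lra.
- by rewrite exprn_gt0.
by rewrite expr2; nra.
Qed.

Lemma cfrac_dist_ge u x y : word u -> 0 <= x <= 1 -> 0 <= y <= 1 ->
  `|x - y| / (4 * cont u ^+ 2) <= `|cfrac u x - cfrac u y|.
Proof.
move=> wu x01 y01; rewrite cfracB// ler_wpM2l//.
have /andP[h1 h1'] := den_bounds wu x01; have /andP[h2 h2'] := den_bounds wu y01.
have := cont_gt0 wu => h; rewrite lef_pV2 ?posrE; last 2 first.
- by rewrite mulr_gt0// exprn_gt0.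
- by rewrite mulr_gt0//; lra.
by rewrite expr2; nra.
Qed.

Lemma cfrac_inj u : word u -> {in `[0, 1] &, injective (@cfrac R u)}.
Proof.
move=> wu x y /[!in_itv]/= x01 y01 xy; have := cfracB wu x01 y01.
rewrite xy subrr normr0 => /esym/eqP; rewrite mulf_eq0 invr_eq0 mulf_eq0.
rewrite (gt_eqF (den_gt0 wu x01)) (gt_eqF (den_gt0 wu y01)) !orbF.
by rewrite normr_eq0 subr_eq0 => /eqP.
Qed.

End Continuants.

(** * The Gauss map *)

Section GaussMap.
Context {R : realType}.
Implicit Types (x y t : R) (u v : seq nat) (k n : nat).

Lemma irrationalV x : irrational x -> irrational x^-1.
Proof.
by move=> xi [q _ qx]; apply: xi; exists q^-1 => //; rewrite fmorphV/= qx invrK.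
Qed.

Lemma irrationalDz x (z : int) : irrational x -> irrational (x + z%:~R).
Proof.
move=> xi [q _ qx]; apply: xi; exists (q - z%:~R) => //.
by rewrite rmorphB /= ratr_int qx addrK.
Qed.

Lemma irr01_gt0 x : irr01 x -> 0 < x < 1.
Proof.
move=> [/andP[x0 x1] xi]; rewrite x1 andbT lt_neqAle x0 andbT eq_sym.
by apply/eqP => x00; apply: xi; exists 0 => //; rewrite x00 rmorph0.
Qed.

Lemma irr01_itv x : irr01 x -> 0 <= x <= 1.
Proof. by move=> /irr01_gt0/andP[x0 x1]; rewrite !ltW. Qed.

Lemma gaussE x : x != 0 -> gauss x = x^-1 - (Num.floor x^-1)%:~R.
Proof. by rewrite /gauss => /negbTE ->. Qed.

Lemma irr01_gauss x : irr01 x -> irr01 (gauss x).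
Proof.
move=> xi; have /andP[x0 x1] := irr01_gt0 xi; rewrite gaussE ?gt_eqF//.
split; last by rewrite -mulrNz; apply: irrationalDz; apply: irrationalV; case: xi.
by rewrite /= subr_ge0 floor_le ltrBlDl -[X in _ + X]/(1%:~R) -intrD floorD1_gt.
Qed.

Lemma iter_irr01 n x : irr01 x -> irr01 (iter n gauss x).
Proof. by move=> xi; elim: n => //= n; exact: irr01_gauss. Qed.

Lemma irr01_step k x : (0 < k)%N -> irr01 x -> irr01 (k%:R + x)^-1.
Proof.
move=> k0 xi; have /andP[x0 x1] := irr01_gt0 xi.
have k1 : 1 <= k%:R :> R by rewrite ler1n.
split; first by rewrite /= invr_ge0 invf_lt1; lra.
by apply: irrationalV; rewrite addrC pmulrn; apply: irrationalDz; case: xi.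
Qed.

Lemma floor_natD k x : 0 <= x < 1 -> Num.floor (k%:R + x) = k.
Proof.
move=> x01; apply/floor_def; rewrite intrD -pmulrn.
by move: x01 => /andP[x0 x1]; rewrite lerDl x0 ltrD2l x1.
Qed.

Lemma gauss_step k x : (0 < k)%N -> 0 <= x < 1 -> gauss (k%:R + x)^-1 = x.
Proof.
move=> k0 x01; have k1 : 1 <= k%:R :> R by rewrite ler1n.
rewrite gaussE ?invrK; last by rewrite invr_eq0 gt_eqF//; lra.
by rewrite floor_natD// -pmulrn; ring.
Qed.

Lemma irr01_cfrac u x : word u -> irr01 x -> irr01 (cfrac u x).
Proof.
by elim: u => //= k u IH /andP[k0 wu] xi; apply: irr01_step => //; exact: IH.
Qed.

Lemma iter_gauss_cfrac u v x : word u -> word v -> irr01 x ->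
  iter (size u) gauss (cfrac (u ++ v) x) = cfrac v x.
Proof.
move=> + wv xi; elim: u => [//|k u IH] /= /andP[k0 wu].
rewrite -iterS iterSr gauss_step ?IH//.
have wuv : word (u ++ v) by rewrite word_cat wu.
by have [] := irr01_cfrac wuv xi.
Qed.

(** Counted from 0: this is a_(n+1)(x), the letter of index n in the expansion. *)
Definition digit n x : nat := `|partial_quotient n.+1 x|%N.

Lemma digitE n x : irr01 x ->
  (0 < digit n x)%N /\ partial_quotient n.+1 x = digit n x :> int.
Proof.
move=> xi; rewrite /digit /partial_quotient /=.
have /andP[y0 y1] := irr01_gt0 (iter_irr01 n xi).
have f1 : 1 <= Num.floor (iter n gauss x)^-1.
  by rewrite floor_ge_int invf_ge1// ltW.
split; first by rewrite absz_gt0 gt_eqF// (lt_le_trans _ f1).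
by rewrite gez0_abs// (le_trans _ f1).
Qed.

Lemma iter_gaussS n x : irr01 x ->
  iter n gauss x = ((digit n x)%:R + iter n.+1 gauss x)^-1.
Proof.
move=> xi; have /andP[y0 y1] := irr01_gt0 (iter_irr01 n xi).
have [_ dE] := digitE n xi; rewrite iterS gaussE ?gt_eqF// pmulrn -dE.
by rewrite /partial_quotient/= addrC subrK invrK.
Qed.

Lemma cfrac_digits n x : irr01 x ->
  cfrac (mkseq (digit^~ x) n) (iter n gauss x) = x.
Proof.
move=> xi; elim: n => [//|n IH].
by rewrite mkseqS -cats1 cfrac_cat /= -iter_gaussS.
Qed.

Lemma word_digits n x : irr01 x -> word (mkseq (digit^~ x) n).
Proof.
by move=> xi; apply/allP => k /mapP[i _ ->]; have [] := digitE i xi.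
Qed.

Lemma digit_cfrac u k v x : word u -> (0 < k)%N -> word v -> irr01 x ->
  digit (size u) (cfrac (u ++ k :: v) x) = k.
Proof.
move=> wu k0 wv xi; rewrite /digit /partial_quotient.
have wkv : word (k :: v) by rewrite /= k0.
rewrite [_.-1]/= iter_gauss_cfrac// [cfrac _ _]/= invrK floor_natD//.
by have [] := irr01_cfrac wv xi.
Qed.

(** As x^-1 is not an integer, the floor is constant near x and only the derivative of the inverse
    remains. *)
Lemma derive1_gauss x : irr01 x -> gauss^`()%classic x = - x ^- 2.
Proof.
move=> xi; have /andP[x0 x1] := irr01_gt0 xi.
set m := Num.floor x^-1.
have mx : m%:~R < x^-1 < (m + 1)%:~R.
  have /andP[m1 ->] := floor_itv x^-1; rewrite lt_neqAle m1 !andbT.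
  apply/eqP => mE; case: xi => _ /irrationalV; apply.
  by exists m%:~R => //; rewrite ratr_int mE.
have near_gauss : \forall y \near x, gauss y = y^-1 - m%:~R.
  have cV : (fun y : R => y^-1) y @[y --> x] --> x^-1.
    by apply: cvgV; rewrite ?gt_eqF.
  move: mx => /andP[m1 m2].
  have : \forall y \near x, m%:~R < y^-1 < (m + 1)%:~R.
    near=> y; apply/andP; split; near: y.
    - by apply: (cvgr_gt _ cV).
    - by apply: (cvgr_lt _ cV).
  move=> h; near=> y.
  have y0 : 0 < y by near: y; exact: lt_nbhsr.
  have /andP[a b] : m%:~R < y^-1 < (m + 1)%:~R by near: y.
  rewrite gaussE ?gt_eqF//; congr (_ - _%:~R).
  by apply/floor_def; rewrite ltW.
rewrite derive1E (near_eq_derive _ near_gauss).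
have dV : is_derive x 1 (fun y : R => y^-1 - m%:~R) (- x ^- 2 *: 1 - 0).
  by apply: is_deriveB; apply: is_deriveV; rewrite gt_eqF.
by rewrite derive_val subr0 /GRing.scale/= mulr1.
Unshelve. all: by end_near. Qed.
End GaussMap.

(** * Pressure and sums over words *)

Section Esum.
Context {R : realType}.
Local Open Scope ereal_scope.

Lemma esumZl (T : choiceType) (I : set T) (a : T -> \bar R) (c : R) :
  (0 <= c)%R -> (forall i, I i -> 0 <= a i) ->
  \esum_(i in I) (c%:E * a i) = c%:E * \esum_(i in I) a i.
Proof.
have le (d : R) (b : T -> \bar R) : (0 <= d)%R -> (forall i, I i -> 0 <= b i) ->
    \esum_(i in I) (d%:E * b i) <= d%:E * \esum_(i in I) b i.
  move=> d0 b0; apply: ge_ereal_sup => _ [X [finX XI]] <-.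
  rewrite fsbig_finite//= big_seq -ge0_sume_distrr -?big_seq; last first.
    by move=> i; rewrite in_fset_set// inE => /XI/b0.
  rewrite lee_pmul//; last first.
    by rewrite -fsbig_finite//; apply: ereal_sup_ubound; exists X.
  by rewrite big_seq sume_ge0// => i; rewrite in_fset_set// inE => /XI/b0.
move=> c0 a0; apply/eqP; rewrite eq_le le//=.
have [->|cn0] := eqVneq c 0%R.
  by rewrite mul0e esum_ge0// => i _; rewrite mul0e.
have {cn0}c0 : (0 < c)%R by rewrite lt_neqAle eq_sym cn0.
(* The reverse inequality is [le] for the factor c^-1 and the family c a. *)
rewrite -lee_pdivlMl//; apply: le_trans (le c^-1%R _ _ _); first last.
- by move=> i Ii; rewrite mule_ge0 ?a0// lee_fin ltW.
- by rewrite invr_ge0 ltW.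
by rewrite le_esum// => i Ii; rewrite muleA -EFinM mulVf ?gt_eqF// mul1e.
Qed.

Lemma le_esum_subset (T : choiceType) (I J : set T) (a : T -> \bar R) :
  I `<=` J -> \esum_(i in I) a i <= \esum_(i in J) a i.
Proof.
move=> IJ; apply: ge_ereal_sup => _ [X [finX XI]] <-; apply: ereal_sup_ubound.
by exists X => //; split=> // x /XI/IJ.
Qed.

Lemma esum_ge_term (T : choiceType) (I : set T) (a : T -> \bar R) i :
  I i -> 0 <= a i -> a i <= \esum_(i in I) a i.
Proof.
by move=> Ii ai; rewrite -[leLHS]esum_set1// le_esum_subset// => _ ->.
Qed.

End Esum.

(** * Almost additive sequences *)

Section Subadditive.
Context {R : realType}.

(* Comparing [a (m * n)] with [n * a m] and with [m * a n] gives
   [(a n - C) / n <= a m / m] for all [m] and [n]. *)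
Lemma linear_growth (a : nat -> R) (C : R) :
  (forall m n, a (m + n)%N <= a m + a n) ->
  (forall m n, a m + a n - C <= a (m + n)%N) ->
  exists P, forall n, n%:R * P <= a n <= n%:R * P + C.
Proof.
move=> sub sup; have a0 := sub 0 0; have a0' := sup 0 0; rewrite addn0 in a0 a0'.
have C0 : 0 <= C by have := sup 0%N 0%N; rewrite addn0; lra.
have up m n : a (n * m)%N <= n%:R * a m + C.
  elim: n => [|n IH]; first by rewrite mul0n mul0r; lra.
  by rewrite mulSn -[in leRHS]natr1; have := sub m (n * m)%N; lra.
have up' m n : a (n.+1 * m)%N <= n.+1%:R * a m.
  elim: n => [|n IH]; first by rewrite mul1n mul1r.
  by rewrite mulSn -[in leRHS]natr1; have := sub m (n.+1 * m)%N; lra.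
have low m n : n.+1%:R * (a m - C) <= a (n.+1 * m)%N.
  elim: n => [|n IH]; first by rewrite mul1n mul1r; lra.
  by rewrite mulSn -[in leLHS]natr1; have := sup m (n.+1 * m)%N; lra.
have cmp m n : (a n.+1 - C) / n.+1%:R <= a m.+1 / m.+1%:R.
  rewrite ler_pdivrMr// mulrAC ler_pdivlMr// mulrC.
  by rewrite (le_trans (low _ _))// mulnC (le_trans (up' _ _))// mulrC.
(* As in Fekete's lemma, the slope is the infimum of a n / n over n >= 1; [cmp] bounds it from
   below. *)
pose A := [set a n.+1 / n.+1%:R | n in setT].
have A0 : A !=set0 by exists (a 1 / 1); exists 0%N.
have lA x : (forall m, x <= a m.+1 / m.+1%:R) -> x <= inf A.
  by move=> xA; apply: lb_le_inf => // _ [m _ <-].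
have hA : has_inf A.
  by split=> //; exists ((a 1 - C) / 1%:R) => _ [m _ <-]; exact: cmp.
exists (inf A) => -[|n]; first by rewrite mul0r; lra.
apply/andP; split.
  by rewrite mulrC -ler_pdivlMr//; apply: ge_inf; [case: hA|exists n].
by rewrite -lerBlDr mulrC -ler_pdivrMr//; apply: lA => m; exact: cmp.
Qed.

End Subadditive.

(** * Sums of powers of continuants *)

Section WordSums.
Context {R : realType}.
Implicit Types (x y t s c : R) (u v : seq nat) (k n : nat).

(** Logarithms turn quasi-multiplicativity into additivity up to ln 2 and make later estimates
    linear. *)
Definition lc u : R := ln (cont u).

Lemma expR_lc u : word u -> expR (lc u) = cont u.
Proof. by move=> wu; rewrite lnK// posrE cont_gt0. Qed.

Lemma lc_ge0 u : word u -> 0 <= lc u.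
Proof. by move=> wu; rewrite ln_ge0// cont_ge1. Qed.

Lemma lc_cat u v : word u -> word v ->
  lc u + lc v <= lc (u ++ v) <= ln 2 + (lc u + lc v).
Proof.
move=> wu wv; have /andP[h1 h2] := cont_cat (R := R) wu wv.
have u0 := cont_gt0 (R := R) wu; have v0 := cont_gt0 (R := R) wv.
have uv0 : 0 < cont (u ++ v) :> R by rewrite cont_gt0// word_cat wu.
rewrite /lc -lnM ?posrE// -lnM ?posrE ?mulr_gt0//.
by rewrite !ler_ln ?posrE ?mulr_gt0// h1.
Qed.

Lemma lc_ge u : word u -> (size u)./2%:R * ln 2 <= lc u.
Proof.
move=> wu; rewrite mulr_natl -lnXn// ler_ln ?posrE ?exprn_gt0 ?cont_gt0//.
exact: cont_ge_pow.
Qed.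

Lemma ln2_gt0 : 0 < ln 2 :> R. Proof. by rewrite ln_gt0// ltr1n. Qed.

(** The term - 1 absorbs the rounding for words of odd length. *)
Lemma lc_ge_linear u : word u -> ((size u)%:R - 1) * ln 2 <= 2 * lc u.
Proof.
move=> wu; have h : (size u)%:R <= 2 * (size u)./2%:R + 1 :> R.
  rewrite -[in leLHS](odd_double_half (size u)) natrD -mul2n natrM addrC.
  by rewrite lerD2l lern1 leq_b1.
by have := lc_ge wu; have := ln2_gt0; nra.
Qed.

(** This is q(u)^(-2s), up to constants the power s of the length of the cylinder of u. *)
Definition wt s u : R := expR (- (2 * s * lc u)).

Lemma wt_gt0 s u : 0 < wt s u. Proof. exact: expR_gt0. Qed.
Lemma wt_ge0 s u : 0 <= wt s u. Proof. exact: expR_ge0. Qed.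

Lemma wt_cat s u v : 0 <= s -> word u -> word v ->
  expR (- (2 * s * ln 2)) * (wt s u * wt s v) <= wt s (u ++ v) <= wt s u * wt s v.
Proof.
move=> s0 wu wv; have /andP[h1 h2] := lc_cat wu wv.
by rewrite /wt -!expRD !ler_expR; nra.
Qed.

Definition words n : set (seq nat) := [set u | word u /\ size u = n].

Definition word_sum s n : \bar R := (\esum_(u in words n) (wt s u)%:E)%E.

Lemma words_cat m n :
  set_bij (words m `*`` fun=> words n) (words (m + n)) (fun p => p.1 ++ p.2).
Proof.
split.
- by move=> [u v] /= [[wu <-] [wv <-]]; split; rewrite ?word_cat ?wu// size_cat.
- move=> [u v] [u' v']; rewrite !inE /= => -[[_ su] _] [[_ su'] _] /= /eqP.
  by rewrite eqseq_cat ?su// => /andP[/eqP -> /eqP ->].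
- move=> w [ww sw]; exists (take m w, drop m w); last by rewrite /= cat_take_drop.
  move: ww; rewrite -{1}(cat_take_drop m w) word_cat => /andP[w1 w2].
  split=> /=; split=> //; first by rewrite size_take sw; case: ltngtP (leq_addr n m).
  by rewrite size_drop sw addKn.
Qed.

Lemma word_sumD_esum s m n : (word_sum s (m + n) =
  \esum_(u in words m) \esum_(v in words n) (wt s (u ++ v))%:E)%E.
Proof.
rewrite esum_esum; last by move=> *; rewrite lee_fin wt_ge0.
exact: reindex_esum (words_cat m n).
Qed.

Lemma word_sum_ge0 s n : (0 <= word_sum s n)%E.
Proof. by apply: esum_ge0 => u _; rewrite lee_fin wt_ge0. Qed.

Definition ones n := nseq n 1%N.

Lemma word_ones n : words n (ones n).
Proof. by split; rewrite ?size_nseq// /word all_nseq orbT. Qed.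

Lemma word_sum_gt0 s n : (0 < word_sum s n)%E.
Proof.
apply: lt_le_trans (esum_ge_term (word_ones n) _); rewrite ?lte_fin ?wt_gt0//.
by rewrite lee_fin wt_ge0.
Qed.

Lemma word_sum_cat s m n (a b : R) : 0 <= s ->
  word_sum s m = a%:E -> word_sum s n = b%:E ->
  ((expR (- (2 * s * ln 2)) * (a * b))%:E <= word_sum s (m + n))%E /\
  (word_sum s (m + n) <= (a * b)%:E)%E.
Proof.
move=> s0 aE bE.
have a0 : 0 <= a by have := word_sum_ge0 s m; rewrite aE lee_fin.
have b0 : 0 <= b by have := word_sum_ge0 s n; rewrite bE lee_fin.
have prodE : (\esum_(u in words m) \esum_(v in words n) (wt s u * wt s v)%:E =
    (a * b)%:E)%E.
  under eq_esum => u _.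
    under eq_esum do rewrite EFinM.
    rewrite esumZl ?wt_ge0//; last by move=> *; rewrite lee_fin wt_ge0.
    rewrite -/(word_sum s n) bE muleC; over.
  rewrite esumZl//; last by move=> *; rewrite lee_fin wt_ge0.
  by rewrite -/(word_sum s m) aE -EFinM mulrC.
split.
- rewrite EFinM -prodE -esumZl ?expR_ge0//; last first.
    by move=> u _; apply: esum_ge0 => v _; rewrite lee_fin mulr_ge0 ?wt_ge0.
  rewrite word_sumD_esum; apply: le_esum => u [wu _].
  rewrite -esumZl ?expR_ge0//; last by move=> v _; rewrite lee_fin mulr_ge0 ?wt_ge0.
  apply: le_esum => v [wv _]; rewrite -EFinM lee_fin.
  by have /andP[] := wt_cat s0 wu wv.
- rewrite word_sumD_esum -prodE; apply: le_esum => u [wu _].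
  apply: le_esum => v [wv _]; rewrite lee_fin.
  by have /andP[] := wt_cat s0 wu wv.
Qed.

Lemma word_sum0 s : word_sum s 0 = 1%E.
Proof.
rewrite /word_sum (_ : words 0 = [set [::]]).
  by rewrite esum_set1 ?lee_fin ?wt_ge0// /wt /lc /cont ln1 mulr0 oppr0 expR0.
by apply/seteqP; split=> [u [_ /size0nil]|_ ->].
Qed.

Lemma word_sum_fin s n : 0 <= s -> (word_sum s 1 < +oo)%E ->
  exists2 a : R, 0 < a & word_sum s n = a%:E.
Proof.
move=> s0 fin1; suff : (word_sum s n < +oo)%E.
  have := word_sum_gt0 s n; case: (word_sum s n) => // r.
  by rewrite lte_fin => r0 _; exists r.
elim: n => [|n]; first by rewrite word_sum0 ltey.
move: fin1; have := word_sum_ge0 s n; have := word_sum_ge0 s 1.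
case E1 : (word_sum s 1) => [a| |]//; case En : (word_sum s n) => [b| |]// _ _ _ _.
have [_] := word_sum_cat s0 E1 En; rewrite add1n => /le_lt_trans; apply.
exact: ltey.
Qed.

(** Keeping only the words that end with n digits 1 costs a positive constant factor. *)
Lemma word_sum_infty s n : 0 <= s -> word_sum s 1 = +oo%E -> word_sum s n.+1 = +oo%E.
Proof.
move=> s0 inf1; apply/eqP; rewrite -leye_eq -add1n word_sumD_esum.
pose c := expR (- (2 * s * ln 2)) * wt s (ones n).
have c0 : 0 < c by rewrite mulr_gt0 ?expR_gt0 ?wt_gt0.
have -> : (+oo = c%:E * word_sum s 1)%E by rewrite inf1 gt0_muley// lte_fin.
rewrite -esumZl ?(ltW c0)//; last by move=> *; rewrite lee_fin wt_ge0.
apply: le_esum => u [wu _].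
have [wo _] := word_ones n; have /andP[h _] := wt_cat s0 wu wo.
have cu : c * wt s u <= wt s (u ++ ones n).
  by rewrite (le_trans _ h)// /c -mulrA (mulrC (wt s u)).
apply: (@le_trans _ _ (wt s (u ++ ones n))%:E); first by rewrite -EFinM lee_fin.
pose a v := (wt s (u ++ v))%:E.
by apply: (@esum_ge_term _ _ _ a _ (word_ones n)); rewrite lee_fin wt_ge0.
Qed.

(* The exponential growth rate [P] of [word_sum s] is the pressure of
   [- s log |T'|]. *)
Definition growth s P := forall n,
  ((expR (n%:R * P))%:E <= word_sum s n)%E /\
  (word_sum s n <= (expR (n%:R * P + 2 * s * ln 2))%:E)%E.

(** By [word_sum_cat], the logarithms of the word sums are almost additive with error 2 s ln 2, so
    [linear_growth] applies. *)
Lemma growth_exists s : 0 <= s -> (word_sum s 1 < +oo)%E -> exists P, growth s P.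
Proof.
move=> s0 fin1; have fin n := word_sum_fin n s0 fin1.
pose a n := fine (word_sum s n).
have aE n : word_sum s n = (a n)%:E by have [b _] := fin n; rewrite /a => ->.
have a0 n : 0 < a n by have [b] := fin n; rewrite /a => + ->.
have aD m n : expR (- (2 * s * ln 2)) * (a m * a n) <= a (m + n)%N <= a m * a n.
  by have := word_sum_cat s0 (aE m) (aE n); rewrite aE !lee_fin => -[-> ->].
have sub m n : ln (a (m + n)%N) <= ln (a m) + ln (a n).
  have /andP[_ h] := aD m n.
  by rewrite -lnM ?posrE// ler_ln ?posrE ?mulr_gt0.
have sup m n : ln (a m) + ln (a n) - 2 * s * ln 2 <= ln (a (m + n)%N).
  have /andP[h _] := aD m n.
  rewrite -ler_expR expRD lnK ?posrE// expRD !lnK ?posrE//.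
  by rewrite mulrC.
have [P HP] := linear_growth sub sup.
exists P => n; rewrite aE !lee_fin; have /andP[h1 h2] := HP n.
by rewrite -[a n]lnK ?posrE// !ler_expR.
Qed.

End WordSums.

(** * The pressure in terms of word sums *)

Section Pressure.
Context {R : realType}.
Implicit Types (x y t s c : R) (u v : seq nat) (k n : nat).

Definition potential s c : R -> R :=
  fun x => - s * ln `|gauss^`()%classic x| - c.

Lemma potentialE s c x : irr01 x -> potential s c x = 2 * s * ln x - c.
Proof.
move=> xi; have /andP[x0 _] := irr01_gt0 xi.
rewrite /potential derive1_gauss// normrN ger0_norm ?invr_ge0 ?exprn_ge0 ?ltW//.
by rewrite lnV ?posrE ?exprn_gt0// lnXn// -mulr_natl; ring.
Qed.

(** The orbit of [cfrac u x] runs through the tails, and [den u x] is the product of their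
    inverses. *)
Lemma birkhoff_cfrac s c u x : word u -> irr01 x ->
  birkhoff_sum (potential s c) (size u) (cfrac u x) =
  - (2 * s * ln (den u x)) - (size u)%:R * c.
Proof.
move=> + xi; elim: u => [|k u IH] wku.
  by rewrite /birkhoff_sum big_ord0 /= ln1 mulr0 mul0r subr0 oppr0.
have /andP[k0 wu] : (0 < k)%N && word u := wku.
rewrite /birkhoff_sum big_ord_recl /= -[(k%:R + cfrac u x)^-1]/(cfrac (k :: u) x).
under eq_bigr => i _.
  rewrite -iterS iterSr [X in iter _ _ X](_ : _ = cfrac u x); last first.
    by rewrite /= gauss_step//; have [] := irr01_cfrac wu xi.
  over.
move: (IH wu); rewrite /birkhoff_sum => ->.
rewrite potentialE; last exact: irr01_cfrac.
have := irr01_itv xi => x01; have /andP[c0 _] := cfrac_itv wu x01.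
have k1 : 1 <= k%:R :> R by rewrite ler1n.
rewrite /= lnV ?lnM ?posrE ?den_gt0//; last by lra.
  by rewrite -natr1; ring.
by lra.
Qed.

Lemma ln_den u x : word u -> 0 <= x <= 1 -> lc u <= ln (den u x) <= ln 2 + lc u.
Proof.
move=> wu x01; have /andP[h1 h2] := den_bounds wu x01.
have u0 := cont_gt0 (R := R) wu; have d0 := den_gt0 wu x01.
by rewrite /lc -lnM ?posrE// !ler_ln ?posrE ?mulr_gt0// h1.
Qed.

(** The suprema in the pressure sums thus range over a nonempty set, as their lower bound
    requires. *)
Lemma irr01_nonempty : exists x : R, irr01 x.
Proof.
have pi2 := pi_ge2 R; exists (pi^-1); split; last exact/irrationalV/pi_irrationnal.
by rewrite /= invr_ge0 pi_ge0 invf_lt1 ?pi_gt0//; lra.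
Qed.

Lemma tuple_words n : set_bij [set a : n.-tuple nat | forall i, (0 < tnth a i)%N]
  (words n) (@tval n nat).
Proof.
split.
- by move=> a /= a0; split; [apply/all_tnthP => i; exact: a0|exact: size_tuple].
- by move=> a b _ _; exact: val_inj.
- move=> u [wu /eqP su]; exists (Tuple su) => //= i.
  by rewrite (tnth_nth 0%N) /=; apply: (allP wu); rewrite mem_nth// (eqP su).
Qed.

(** By bounded distortion, [den u x] and [cont u] differ by a factor at most 2, uniformly in x; this
    factor enters with the power 2 s. *)
Lemma pressure_sum_bounds s c n : 0 <= s ->
  ((expR (- (n%:R * c + 2 * s * ln 2)))%:E * word_sum s n
     <= pressure_sum (potential s c) n)%E /\
  (pressure_sum (potential s c) n <= (expR (- (n%:R * c)))%:E * word_sum s n)%E.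
Proof.
move=> s0; rewrite /word_sum /pressure_sum.
rewrite (reindex_esum _ _ _ (fun u => (wt s u)%:E) (tuple_words n)).
rewrite -!esumZl ?expR_ge0//; try by move=> *; rewrite lee_fin wt_ge0.
split; apply: le_esum => a a0.
- have [wa sa] : words n a by case: (tuple_words n) => + _ _; apply.
  have [x xi] := irr01_nonempty.
  apply: (@le_trans _ _ (expR (birkhoff_sum (potential s c) n (cfrac a x)))%:E);
    last first.
    by apply: ereal_sup_ubound; exists x.
  rewrite -EFinM lee_fin /wt -expRD ler_expR -{3}sa birkhoff_cfrac// sa.
  have /andP[_ h] := ln_den wa (irr01_itv xi); nra.
- have [wa sa] : words n a by case: (tuple_words n) => + _ _; apply.
  apply: ge_ereal_sup => _ [x xi <-].
  rewrite -EFinM lee_fin /wt -expRD ler_expR -{1}sa birkhoff_cfrac// sa.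
  have /andP[h _] := ln_den wa (irr01_itv xi); nra.
Qed.

Lemma pressure_infty s c : 0 <= s -> word_sum s 1 = +oo%E ->
  pressure (potential s c) = +oo%E.
Proof.
move=> s0 inf1; have h n : pressure_sum (potential s c) n.+1 = +oo%E.
  have [+ _] := pressure_sum_bounds c n.+1 s0.
  by rewrite word_sum_infty// gt0_muley ?lte_fin ?expR_gt0// leye_eq => /eqP.
apply: lim_near_cst => //; exists 1%N => // -[//|n] _ /=.
by rewrite h gt0_muley// lte_fin invr_gt0.
Qed.

(** The logarithm of the n-th pressure sum is n (P - c) up to a bounded error, which disappears
    after division by n. *)
Lemma pressure_growth s c P : 0 <= s -> growth s P ->
  pressure (potential s c) = (P - c)%:E.
Proof.
move=> s0 gP; pose C := 2 * s * ln 2.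
have C0 : 0 <= C by rewrite /C mulr_ge0 ?(ltW ln2_gt0)// mulr_ge0.
pose z n := pressure_sum (potential s c) n.
have zE n : exists2 a : R, z n = (expR a)%:E & `|a - n%:R * (P - c)| <= C.
  have [l1 l2] := pressure_sum_bounds c n s0; have [g1 g2] := gP n.
  have L : ((expR (n%:R * (P - c) - C))%:E <= z n)%E.
    apply: le_trans l1; apply: le_trans (lee_wpmul2l _ g1); last first.
      by rewrite lee_fin expR_ge0.
    by rewrite -EFinM -expRD lee_fin ler_expR /C; lra.
  have U : (z n <= (expR (n%:R * (P - c) + C))%:E)%E.
    apply: (le_trans l2); apply: (le_trans (lee_wpmul2l _ g2)).
      by rewrite lee_fin expR_ge0.
    by rewrite -EFinM -expRD lee_fin ler_expR /C; lra.
  case: (z n) L U => // r; rewrite !lee_fin => L U.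
  have r0 : 0 < r by rewrite (lt_le_trans _ L) ?expR_gt0.
  exists (ln r); first by rewrite lnK ?posrE.
  move: L U; rewrite -{1 2}[r]lnK ?posrE// !ler_expR ler_norml; lra.
pose a n := projT1 (cid2 (zE n)).
have aP n : z n = (expR (a n))%:E /\ `|a n - n%:R * (P - c)| <= C.
  by rewrite /a; case: cid2.
rewrite /pressure (_ : (fun _ => _) = EFin \o (fun n => n%:R^-1 * a n)); last first.
  apply/funext => n /=; rewrite -/(z n) (aP n).1 lne_EFin ?expR_gt0// expRK.
  by rewrite EFinM.
apply: cvg_lim => //; apply: cvg_EFin; first by apply: nearW.
apply/cvgrPdist_le => e e0; near=> n.
have n0 : 0 < n%:R :> R by rewrite ltr0n; near: n; exact: nbhs_infty_gt.
rewrite distrC.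
rewrite (_ : n%:R^-1 * a n - (P - c) = (a n - n%:R * (P - c)) / n%:R); last first.
  by field; rewrite gt_eqF.
rewrite normrM normfV (ger0_norm (ltW n0)) ler_pdivrMr//.
apply: le_trans (aP n).2 _; rewrite mulrC -ler_pdivrMr//; near: n.
exact: nbhs_infty_ger.
Unshelve. all: by end_near. Qed.

(** This removes the limit from the rest of the proof. A nonpositive pressure forces a finite first
    word sum, hence a growth rate. *)
Lemma pressure_le0 s c : 0 <= s ->
  (pressure (potential s c) <= 0)%E <-> exists2 P, growth s P & P <= c.
Proof.
move=> s0; split=> [|[P gP Pc]]; last first.
  by rewrite (pressure_growth c s0 gP) lee_fin subr_le0.
have [fin1|] := ltP (word_sum s 1) +oo%E.
  have [P gP] := growth_exists s0 fin1.
  by rewrite (pressure_growth c s0 gP) lee_fin subr_le0; exists P.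
by rewrite leye_eq => /eqP h; rewrite (pressure_infty c s0 h).
Qed.

End Pressure.

(** * Monotonicity of the growth rate, and its sign at s = 1 *)

Section GrowthBounds.
Context {R : realType}.
Implicit Types (x y t s c : R) (u v : seq nat) (k n : nat).

Lemma le_of_linear x y c : (forall n, n%:R * x <= n%:R * y + c) -> x <= y.
Proof.
move=> h; rewrite leNgt; apply/negP => yx.
have := h (Num.truncn (c / (x - y))).+1; rewrite -lerBlDl -mulrBr.
rewrite -ler_pdivlMr ?subr_gt0// leNgt => /negP; apply.
exact: truncnS_gt.
Qed.

(** Since q(u)^2 >= 2^(n - 1) for words of length n, raising s to s' gains a factor 2^(-(s' - s)(n -
    1)) in every term. The strict decrease later turns a weak inequality at s into a strict one at
    s' > s. *)
Lemma growth_decr s s' P : 0 <= s <= s' -> growth s P ->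
  exists2 P', growth s' P' & P' <= P - (s' - s) * ln 2.
Proof.
move=> /andP[s0 ss'] gP; have s0' := le_trans s0 ss'.
have l2 := @ln2_gt0 R.
have sumle n : (word_sum s' n <=
    (expR (n%:R * (P - (s' - s) * ln 2) + (2 * s + (s' - s)) * ln 2))%:E)%E.
  have [_ g] := gP n; pose d := (s' - s) * (1 - n%:R) * ln 2.
  have -> : n%:R * (P - (s' - s) * ln 2) + (2 * s + (s' - s)) * ln 2 =
    d + (n%:R * P + 2 * s * ln 2) by rewrite /d; ring.
  rewrite expRD EFinM; apply: le_trans (lee_wpmul2l _ g); last first.
    by rewrite lee_fin expR_ge0.
  rewrite -esumZl ?expR_ge0//; last by move=> u _; rewrite lee_fin wt_ge0.
  apply: le_esum => u [wu su]; rewrite -EFinM lee_fin /wt -expRD ler_expR.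
  have := lc_ge_linear (R := R) wu; rewrite su /d => h2.
  have h3 : 0 <= (s' - s) * (2 * lc u + (1 - n%:R) * ln 2).
    by rewrite mulr_ge0 ?subr_ge0//; lra.
  by lra.
have [|P' gP'] := @growth_exists R s' s0'.
  by rewrite (le_lt_trans (sumle 1%N)) ?ltey.
exists P' => //; apply: (@le_of_linear _ _ ((2 * s + (s' - s)) * ln 2)) => n.
by rewrite -ler_expR -lee_fin; apply: le_trans (sumle n); have [] := gP' n.
Qed.

(* The length of the cylinder of [u]. *)
Let V u : R := (den u 0 * den u 1)^-1.

Let V_ge0 u : word u -> 0 <= V u.
Proof. by move=> wu; rewrite invr_ge0 mulr_ge0// ltW// den_gt0// ?lexx ler01. Qed.

(** The child k is the interval between [cfrac u] at 1 / k and at 1 / (k + 1). The subtracted term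
    is the length of what is left between 0 and 1 / (n + 1). *)
Let V_telescope u n : word u ->
  \sum_(1 <= k < n.+1) V (u ++ [:: k]) =
  V u - (n.+1%:R * den u 0 * den u n.+1%:R^-1)^-1.
Proof.
move=> wu; have [q [q' [p [p' [q0 qq _ _ H]]]]] := den_affine (R := R) wu.
have dE t : 0 <= t <= 1 -> den u t = q + q' * t by case/H.
have d0 t : 0 <= t <= 1 -> 0 < q + q' * t by move=> t01; rewrite -dE ?den_gt0.
have q1 : 0 < q by have := d0 0; rewrite lexx ler01 mulr0 addr0; apply.
elim: n => [|n IH].
  by rewrite big_geq// mul1r invr1 subrr.
rewrite big_nat_recr//= {}IH /V !den_cat /= !addr0 !mulr1.
have i01 k : 0 <= (k.+1%:R^-1 : R) <= 1 by rewrite invr_ge0 ler0n invf_le1// ler1n.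
have n1 : n.+1%:R + 1 = n.+2%:R :> R by rewrite natr1.
rewrite n1 !dE ?i01// ?lexx ?ler01//.
have e1 := d0 _ (i01 n); have e2 := d0 _ (i01 n.+1).
have k0 : 0 < n.+1%:R :> R by []. have k1 : 0 < n.+2%:R :> R by [].
rewrite -n1 in k1 e2 *; move: k0 k1 e1 e2; set k : R := n.+1%:R => k0 k1 e1 e2.
have e3 : 0 < q + q' by have := d0 1; rewrite lexx ler01 mulr1; apply.
have f1 : 0 < q * k + q'.
  by rewrite -(pmulr_lgt0 _ (x := k^-1)) ?invr_gt0// mulrDl mulfK ?gt_eqF.
have f2 : 0 < q * (k + 1) + q'.
  by rewrite -(pmulr_lgt0 _ (x := (k + 1)^-1)) ?invr_gt0// mulrDl mulfK ?gt_eqF.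
field.
by rewrite !gt_eqF//=; rewrite ?mulr0 ?addr0 ?mulr1; lra.
Qed.

Let V_children u : word u -> (\esum_(v in words 1) (V (u ++ v))%:E <= (V u)%:E)%E.
Proof.
move=> wu; have b : set_bij [set k | (0 < k)%N] (words 1) (fun k => [:: k]).
  split.
  - by move=> k /= k0; split; rewrite //= k0.
  - by move=> k l _ _ [].
  - move=> v [wv sv]; case: v wv sv => [|k [|? ?]] //= /andP[k0 _] _.
    by exists k.
rewrite (reindex_esum _ _ _ _ b) -nneseries_esum; last first.
  by move=> k k0; rewrite lee_fin V_ge0// word_cat wu /= k0.
apply: lime_le.
  apply: is_cvg_nneseries => k _ k0.
  by rewrite lee_fin V_ge0// word_cat wu /= k0.
apply: nearW => -[|n]; first by rewrite big_geq// lee_fin V_ge0.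
rewrite sumEFin big_mkcond big_nat_recl//= add0r.
have -> : \sum_(0 <= i < n) V (u ++ [:: i.+1]) = \sum_(1 <= k < n.+1) V (u ++ [:: k]).
  by rewrite big_add1.
rewrite V_telescope// lee_fin gerBl invr_ge0 !mulr_ge0// ltW// den_gt0//.
  by rewrite lexx ler01.
by rewrite invr_ge0 ler0n invf_le1// ler1n.
Qed.

Let V_sum n : (\esum_(u in words n) (V u)%:E <= 1)%E.
Proof.
elim: n => [|n IH].
  rewrite (_ : words 0 = [set [::]]); last first.
    by apply/seteqP; split=> [u [_ /size0nil]|_ ->].
  by rewrite esum_set1 ?lee_fin ?V_ge0// /V /= mulr1 invr1.
rewrite -addn1; apply: le_trans IH.
rewrite (reindex_esum _ _ _ _ (words_cat n 1)).
rewrite -(@esum_esum _ _ _ _ _ (fun u v => (V (u ++ v))%:E)); last first.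
  by move=> u v [wu _] [wv _]; rewrite lee_fin V_ge0// word_cat wu.
by apply: le_esum => u [wu _]; exact: V_children.
Qed.

(** At s = 1 a weight is at most twice the length of the cylinder, and the lengths of one level add
    up to at most 1. Hence the exponent 1 is always admissible in the formula. *)
Lemma growth1 : exists2 P, growth (1 : R) P & P <= 0.
Proof.
have sumle n : (word_sum (1 : R) n <= 2%:E)%E.
  apply: (@le_trans _ _ (2%:E * \esum_(u in words n) (V u)%:E)%E); last first.
    by rewrite -[leRHS]mule1 lee_wpmul2l ?lee_fin.
  rewrite -esumZl//; last by move=> u [wu _]; rewrite lee_fin V_ge0.
  apply: le_esum => u [wu _]; rewrite -EFinM lee_fin /wt mulr1.
  rewrite expRN expRM_natl expR_lc// /V.
  have q0 := cont_gt0 (R := R) wu.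
  have /andP[d1 d2] := @den_bounds R u 1 wu (introT andP (conj ler01 (lexx 1))).
  have d0 : 0 < den u 1 := lt_le_trans q0 d1.
  rewrite -/(cont u) ler_pdivlMr ?mulr_gt0// mulrC ler_pdivrMr ?exprn_gt0//.
  by rewrite expr2; nra.
have [|P gP] := @growth_exists R 1 ler01.
  by rewrite (le_lt_trans (sumle 1%N)) ?ltey.
exists P => //; apply: (@le_of_linear _ _ (ln 2)) => n.
rewrite mulr0 add0r -ler_expR lnK ?posrE// -lee_fin.
by apply: le_trans (sumle n); have [] := gP n.
Qed.

End GrowthBounds.

(** * The function [f_t] *)

Section ExponentF.
Context {R : realType}.
Variables (t0 t1 : R).
Hypotheses (ht0 : 0 < t0) (ht1 : 0 < t1).
Implicit Types s : R.

Lemma f_t0 : f_t t0 t1 0 = 0.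
Proof. by rewrite /f_t expr0n mul0r. Qed.

(** f(s) is the minimum of s / t1 and s^2 / (t0 s + t1 (1 - s)), here written without divisions. *)
Lemma f_tP s : 0 < s <= 1 -> let f := f_t t0 t1 s in
  [/\ 0 < f, f * t1 <= s, f * (t0 * s + t1 * (1 - s)) <= s ^+ 2 &
      f * t1 = s \/ f * (t0 * s + t1 * (1 - s)) = s ^+ 2].
Proof.
move=> /andP[s0 s1] /=; rewrite /f_t; set m := Num.max _ _.
pose D := t0 * s + t1 * (1 - s).
have D0 : 0 < D by rewrite ltr_wpDr ?mulr_gt0// mulr_ge0 ?subr_ge0 ?(ltW ht1).
have dE : D = t0 * t1 * (s / t1 + (1 - s) / t0).
  by rewrite /D; field; rewrite !gt_eqF.
have eE : s * t1 = t0 * t1 * (s / t0) by field; rewrite gt_eqF.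
have t01 : 0 < t0 * t1 by rewrite mulr_gt0.
have [mD|mE] : t0 * t1 * m = D \/ t0 * t1 * m = s * t1.
- by rewrite /m dE eE /Num.max; case: ifP; [right|left].
- have le : s * t1 <= D by rewrite -mD eE ler_pM2l// le_max lexx orbT.
  rewrite mD -/D; split.
  + by rewrite divr_gt0// exprn_gt0.
  + by rewrite mulrAC ler_pdivrMr// expr2; nra.
  + by rewrite divfK// gt_eqF.
  + by right; rewrite divfK// gt_eqF.
- have le : D <= s * t1 by rewrite -mE dE ler_pM2l// le_max lexx.
  rewrite mE -/D; have -> : s ^+ 2 / (s * t1) = s / t1.
    by field; rewrite !gt_eqF.
  split.
  + by rewrite divr_gt0.
  + by rewrite divfK// gt_eqF.
  + by rewrite mulrAC ler_pdivrMr// expr2; nra.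
  + by left; rewrite divfK// gt_eqF.
Qed.

(** Both functions of which f is the minimum are nondecreasing, so it suffices to treat the one
    attained at s'. *)
Lemma f_t_le s s' : 0 <= s <= s' -> s' <= 1 -> f_t t0 t1 s <= f_t t0 t1 s'.
Proof.
move=> /andP[]; rewrite le_eqVlt => /predU1P[<-|s0] ss' s'1.
  rewrite f_t0; move: ss'; rewrite le_eqVlt => /predU1P[<-|s'0]; first by rewrite f_t0.
  by have [/ltW] := @f_tP s' (introT andP (conj s'0 s'1)).
have s'0 := lt_le_trans s0 ss'; have s1 := le_trans ss' s'1.
have [f0 f1 f2 _] := @f_tP s (introT andP (conj s0 s1)).
have [g0 _ _ [g|g]] := @f_tP s' (introT andP (conj s'0 s'1)).
  by rewrite -(ler_pM2r ht1) g (le_trans f1).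
set f := f_t _ _ _ in f0 f1 f2 *; set f' := f_t _ _ _ in g0 g *.
pose D := t0 * s + t1 * (1 - s); pose D' := t0 * s' + t1 * (1 - s').
have D0 : 0 < D by rewrite ltr_wpDr ?mulr_gt0// mulr_ge0 ?subr_ge0 ?(ltW ht1).
have D0' : 0 < D' by rewrite ltr_wpDr ?mulr_gt0// mulr_ge0 ?subr_ge0 ?(ltW ht1).
rewrite -(ler_pM2r D0') g -(ler_pM2r D0).
(* After clearing denominators, the terms in t1 compare by [h1] and those in t0 by [h2]. *)
have h1 : s ^+ 2 * (1 - s') <= s' ^+ 2 * (1 - s).
  apply: ler_pM; rewrite ?sqr_ge0 ?subr_ge0//; last by lra.
  by rewrite !expr2; nra.
have h2 : 0 <= t0 * s * s' * (s' - s).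
  by rewrite !mulr_ge0 ?subr_ge0// ltW.
have h3 := ler_wpM2l (ltW ht1) h1.
have h : D' * s ^+ 2 <= s' ^+ 2 * D by rewrite /D /D'; lra.
by apply: le_trans h; rewrite (mulrC D') mulrAC ler_pM2r.
Qed.

End ExponentF.

(** * Upper bound *)

Section LimitInferior.
Context {R : realType}.
Implicit Types (u : (\bar R)^nat) (b : \bar R).
Local Open Scope ereal_scope.

Lemma limn_einf_sup_einfs u : limn_einf u = ereal_sup (range (einfs u)).
Proof. by rewrite limn_einf_lim; apply: cvg_lim => //; exact: cvg_einfs_sup. Qed.

Lemma lt_limn_einf u b : b < limn_einf u ->
  exists N, forall n, (N <= n)%N -> b < u n.
Proof.
rewrite limn_einf_sup_einfs => /ereal_sup_gt[_ [N _ <-] bN].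
by exists N => n Nn; apply: (lt_le_trans bN); apply: ereal_inf_lbound; exists n.
Qed.

Lemma limn_einf_lt u b : limn_einf u < b ->
  forall N, exists2 n, (N <= n)%N & u n < b.
Proof.
rewrite limn_einf_sup_einfs => ub N.
have : einfs u N < b by apply: le_lt_trans ub; apply: ereal_sup_ubound; exists N.
by move=> /ereal_inf_lt[_ [n Nn <-] unb]; exists n.
Qed.

Lemma infinite_natP (A : set nat) :
  infinite_set A <-> forall N, exists2 n, (N <= n)%N & A n.
Proof.
split=> [Ainf N|h Afin].
  apply: contrapT => h; apply: Ainf; apply: (@sub_finite_set _ _ `I_N) => // n An.
  by rewrite /= ltnNge; apply/negP => Nn; apply: h; exists n.
have [r rA] := (finite_seqP A).1 Afin.
have [n + An] := h (\max_(i <- r) i).+1; have : n \in r by have := An; rewrite rA.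
by move=> nB; rewrite ltnNge (@leq_bigmax_seq _ r xpredT id n nB).
Qed.

End LimitInferior.

(** * Hausdorff contents of countable covers *)

Section HausdorffFacts.
Context {R : realType}.
Local Open Scope ereal_scope.
Implicit Types (E U : set R) (s d : R).

Lemma diam_pow_ge0 s U : 0 <= diam_pow s U.
Proof. by rewrite /diam_pow; case: ifP => // _; exact: poweR_ge0. Qed.

Lemma diam_le U d : (forall x y, U x -> U y -> `|x - y| <= d)%R -> diam U <= d%:E.
Proof.
by move=> h; apply: ge_ereal_sup => _ [[x y] [/= Ux Uy] <-]; rewrite lee_fin h.
Qed.

Lemma diam_ge U x y : U x -> U y -> `|x - y|%:E <= diam U.
Proof. by move=> Ux Uy; apply: ereal_sup_ubound; exists (x, y). Qed.

Lemma diam_ge0 U x : U x -> 0 <= diam U.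
Proof. by move=> Ux; have := diam_ge Ux Ux; rewrite subrr normr0. Qed.

Lemma diam_pow_le s U d : (0 <= s)%R -> diam U <= d%:E -> (0 <= d)%R ->
  diam_pow s U <= (d `^ s)%:E.
Proof.
move=> s0 Ud d0; rewrite /diam_pow; case: ifPn => [_|].
  by rewrite lee_fin powR_ge0.
move=> /set0P[x Ux]; rewrite -poweR_EFin gt0_ler_poweR// in_itv/= ?leey ?andbT.
- exact: diam_ge0 Ux.
- by rewrite lee_fin.
Qed.

(** The cover is made a sequence through [pickle]. Indices that code nothing get the empty set,
    whose diameter is -oo and whose [diam_pow] is 0. *)
Lemma hausdorff_content_countable (T : countType) (I : set T) (U : T -> set R)
    s d (e : R) E :
  E `<=` \bigcup_(p in I) U p -> (forall p, I p -> diam (U p) <= d%:E) ->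
  \esum_(p in I) diam_pow s (U p) <= e%:E ->
  hausdorff_content s d E <= e%:E.
Proof.
move=> EU Ud Ue; pose V i := if pickle_inv i is Some p then
  if p \in I then U p else set0 else set0.
have diam0 : diam set0 = -oo :> \bar R.
  rewrite /diam (_ : [set _ | _ in _] = set0) ?ereal_sup0//.
  by apply/seteqP; split => // _ [[x y] [[]]].
apply: le_trans Ue; apply: (@le_trans _ _ (\sum_(0 <= i <oo) diam_pow s (V i))).
  apply: ereal_inf_lbound; exists V => //; split.
  - move=> x /EU[p Ip Ux]; exists (pickle p) => //.
    by rewrite /V pickleK_inv mem_set.
  - move=> i; rewrite /V; case: pickle_inv => [p|]; last by rewrite diam0 leNye.
    by case: ifPn => [/set_mem/Ud|_] //; rewrite diam0 leNye.
rewrite nneseries_esumT; last by move=> i; exact: diam_pow_ge0.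
rewrite [leLHS](_ : _ = \esum_(i in pickle @` I) diam_pow s (V i)).
  rewrite esum_image; last by move=> p q _ _; exact: (pcan_inj pickleK).
  by apply: le_esum => p Ip; rewrite /V pickleK_inv mem_set.
rewrite [RHS]esum_mkcond; apply: eq_esum => i _; case: ifPn => // /negP iI.
rewrite /V /diam_pow; case E1 : (pickle_inv i) => [p|]; last by rewrite eqxx.
have [/set_mem Ip|_] := boolP (p \in I); last by rewrite eqxx.
exfalso; apply: iI; apply/mem_set; exists p => //.
by have := pickle_invK (T := T) i; rewrite E1.
Qed.

End HausdorffFacts.

(** * Series and diameters for the upper bound *)

Section Estimates.
Context {R : realType}.
Implicit Types (a c e x : R) (u v : seq nat) (k m n N : nat).

Lemma expR_small c e : 0 < c -> 0 < e ->
  exists N0, forall N, (N0 <= N)%N -> expR (- (N%:R * c)) <= e.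
Proof.
move=> c0 e0; exists (Num.truncn (- ln e / c)).+1 => N NN.
rewrite -[e]lnK ?posrE// ler_expR lerNl -ler_pdivrMr//.
apply/ltW/(lt_le_trans (truncnS_gt _)); by rewrite ler_nat.
Qed.

Lemma harmonic_le n : \sum_(1 <= k < n.+2) k%:R^-1 <= 1 + ln n.+1%:R :> R.
Proof.
elim: n => [|n IH]; first by rewrite big_nat1 ln1 invr1 addr0.
rewrite big_nat_recr//=; apply: (le_trans (lerD IH (lexx _))).
have n2 : 0 < n.+2%:R :> R by [].
have : ln (1 + - n.+2%:R^-1) <= - n.+2%:R^-1 :> R.
  by apply: le_ln1Dx; rewrite ltrNl opprK invf_lt1// ltr1n.
have -> : 1 + - n.+2%:R^-1 = n.+1%:R / n.+2%:R :> R.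
  apply: (mulIf (lt0r_neq0 n2)); rewrite mulfVK ?gt_eqF// -[n.+2%:R]natr1.
  by rewrite mulrDl mul1r mulNr mulVf; [ring | rewrite natr1].
rewrite ln_div ?posrE//; move: (ln _) (ln _) (_^-1) => x y z; lra.
Qed.

(* The value 1 at 0 accounts for the piece with a large digit. *)
Definition harm k : R := (k == 0)%N%:R + k%:R^-1.

Lemma harm_ge0 k : 0 <= harm k.
Proof. by rewrite addr_ge0 ?ler0n// invr_ge0 ler0n. Qed.

Lemma harm_sum x : 1 <= x ->
  (\esum_(k in [set k : nat | (k%:R <= x)%R]) (harm k)%:E <= (2 + ln x)%:E)%E.
Proof.
move=> x1; pose K := Num.truncn x.
have K0 : (0 < K)%N by rewrite truncn_gt0.
have Kx : K%:R <= x by rewrite truncn_le// (le_trans ler01).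
apply: (@le_trans _ _ (\esum_(k in `I_K.+1) (harm k)%:E)%E).
  apply: le_esum_subset => k /= kx; rewrite -(ltr_nat R).
  exact: le_lt_trans kx (truncnS_gt x).
rewrite esum_fset//; last by move=> k _; rewrite lee_fin harm_ge0.
rewrite -fsbig_ord sumEFin lee_fin -(big_mkord xpredT harm) big_nat_recl//.
rewrite -(big_add1 _ _ 0 K.+1 xpredT harm).
have -> : \sum_(1 <= k < K.+1) harm k = \sum_(1 <= k < K.+1) k%:R^-1.
  by apply: eq_big_nat => -[|k] // _; rewrite /harm add0r.
rewrite /harm eqxx invr0 addr0 -(prednK K0).
apply: le_trans (lerD (lexx _) (harmonic_le _)) _.
by rewrite prednK// addrA lerD2l ler_ln ?posrE ?ltr0n// (lt_le_trans ltr01).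
Qed.

Lemma geometric_tail c N : 0 < c ->
  (\esum_(m in [set m | (N <= m)%N]) (expR (- (m%:R * c)))%:E
     <= (expR (- (N%:R * c)) / (1 - expR (- c)))%:E)%E.
Proof.
move=> c0; pose r := expR (- c).
have r01 : 0 < r < 1 by rewrite expR_gt0 /r expR_lt1 oppr_lt0.
have /andP[r0 r1] := r01.
have b : set_bij [set: nat] [set m | (N <= m)%N] (addn N).
  split; first by move=> m _ /=; exact: leq_addr.
  - by move=> m n _ _; exact: addnI.
  - by move=> m /= Nm; exists (m - N)%N => //; rewrite subnKC.
rewrite (reindex_esum _ _ _ _ b).
under eq_esum => m _ do rewrite natrD mulrDl opprD expRD EFinM.
rewrite esumZl ?expR_ge0//.
rewrite EFinM lee_wpmul2l ?lee_fin ?expR_ge0// -nneseries_esumT; last first.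
  by move=> m; rewrite lee_fin expR_ge0.
apply: lime_le.
  by apply: is_cvg_nneseries => m _ _; rewrite lee_fin expR_ge0.
apply: nearW => n; rewrite sumEFin lee_fin.
have -> : \sum_(0 <= m < n) expR (- (m%:R * c)) = (1 - r ^+ n) / (1 - r).
  elim: n => [|n IH]; first by rewrite big_geq// expr0 subrr mul0r.
  rewrite big_nat_recr//= IH exprSr -mulrN mulrC expRM_natl -/r.
  by field; rewrite gt_eqF// subr_gt0.
rewrite -/r ler_pdivrMr ?subr_gt0// mulVf ?gt_eqF ?subr_gt0//.
by rewrite gerBl exprn_ge0// ltW.
Qed.

(** The first bound serves for the cost of a piece, the second, independent of a, for the mesh of
    the cover. *)
Lemma diam_cfrac v a : word v ->
  let U := cfrac v @` [set t | 0 <= t <= 1 /\ t <= expR (- a)] in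
  (diam U <= (expR (- a - 2 * lc v))%:E)%E /\ (diam U <= (expR (- (2 * lc v)))%:E)%E.
Proof.
move=> wv U; have U_le d x y : 0 <= d -> U x -> U y ->
    (forall t, 0 <= t <= 1 -> t <= expR (- a) -> t <= d) ->
    `|x - y| <= d * expR (- (2 * lc v)).
  move=> d0 [t [t01 ta] <-] [t' [t01' ta'] <-] h.
  apply: le_trans (cfrac_dist_le wv t01 t01') _.
  rewrite expRN expRM_natl expR_lc// ler_pM2r ?invr_gt0 ?exprn_gt0 ?cont_gt0//.
  have := h _ t01 ta; have := h _ t01' ta'; rewrite ler_norml; lra.
split; apply: diam_le => x y Ux Uy.
- by rewrite expRD U_le ?expR_ge0.
- by rewrite -[leRHS]mul1r U_le// => t /andP[].
Qed.

End Estimates.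

(** * The cover and its cost *)

Section UpperBound.
Context {R : realType}.
Variables (t0 t1 b s P : R).
Hypotheses (ht0 : 0 < t0) (ht1 : 0 < t1) (hb : 0 < b) (hs : 0 < s <= 1).
Let f := f_t t0 t1 s.
Hypotheses (hP : growth s P) (hPf : P < f * b).
Implicit Types (u v : seq nat) (k m n N : nat).

(** The logarithm of the threshold A, chosen so that A^(-s) = e^(-b f). *)
Let ab := f * b / s.

Let s0 : 0 < s. Proof. by case/andP: hs. Qed.
Let f0 : 0 < f. Proof. by have [] := f_tP ht0 ht1 hs. Qed.
Let ab0 : 0 < ab. Proof. by rewrite divr_gt0// mulr_gt0. Qed.

Let index N : set (nat * seq nat * nat) :=
  ([set m | (N <= m)%N] `*`` @words) `*``
  (fun mu => [set k | k%:R <= expR (mu.1.+1%:R * ab)]).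

(* [k = 0] covers the points with a large n-th digit, n = m + 1; the other
   values of [k] are the possible small n-th digits. *)
Let piece (p : nat * seq nat * nat) : set R :=
  let: (m, u, k) := p in
  if k is 0%N then cfrac u @` [set t | 0 <= t <= 1 /\ t <= expR (- (m.+1%:R * ab))]
  else cfrac (u ++ [:: k]) @`
    [set t | 0 <= t <= 1 /\ t <= expR (- ((m.+1%:R * b - t0 * ln k%:R) / t1))].

(* Both sides are affine in [l], so that only the end points matter. *)
Let exponent_le (y l : R) : 0 < y -> 0 <= l -> l <= f * y / s ->
  s * (- ((y - t0 * l) / t1) - 2 * l) <= - (y * f) - l.
Proof.
move=> y0 l0 ly; have [_ f1 fD _] := f_tP ht0 ht1 hs; rewrite -/f in f1 fD.
have {}ly : s * l <= f * y by rewrite mulrC -ler_pdivlMr.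
have -> : s * (- ((y - t0 * l) / t1) - 2 * l) =
  (- (s * y) + s * t0 * l - 2 * s * t1 * l) / t1 by field; rewrite gt_eqF.
rewrite ler_pdivrMr//.
(* For a nonpositive slope the end l = 0 decides and needs f t1 <= s; otherwise the end l = f y / s
   decides and needs [fD]. *)
have [c0|c0] := lerP (t1 - 2 * s * t1 + s * t0) 0; first by nra.
have h1 : (s * l) * (t1 - 2 * s * t1 + s * t0) <= (f * y) * (t1 - 2 * s * t1 + s * t0).
  by rewrite ler_pM2r.
have h2 : y * (f * (t0 * s + t1 * (1 - s))) <= y * s ^+ 2 by rewrite ler_pM2l.
by rewrite -(ler_pM2l s0); lra.
Qed.

(** For k = 0 this is the choice of [ab]. For k >= 1 the continuant of the word of the piece is at
    least q(u) k, and [exponent_le] with l = ln k leaves a factor 1 / k. *)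
Let piece_cost N p : index N p ->
  (diam_pow s (piece p) <=
     (wt s p.1.2 * (expR (- (p.1.1.+1%:R * (f * b))) * harm p.2))%:E)%E.
Proof.
case: p => [[m u] k] [/= [Nm [wu su]]]; case: k => [|k] kA.
- have [d _] := diam_cfrac (m.+1%:R * ab) wu.
  apply: le_trans (diam_pow_le (ltW s0) d (expR_ge0 _)) _.
  rewrite lee_fin -expRM /harm invr0 addr0 mulr1 /wt -expRD ler_expR.
  have -> : (- (m.+1%:R * ab) - 2 * lc u) * s =
    - (m.+1%:R * (ab * s)) - 2 * s * lc u by ring.
  by rewrite /ab divfK ?gt_eqF//; lra.
- have wk : word [:: k.+1] by [].
  have wuk : word (u ++ [:: k.+1]) by rewrite word_cat wu.
  have [d _] := diam_cfrac ((m.+1%:R * b - t0 * ln k.+1%:R) / t1) wuk.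
  apply: le_trans (diam_pow_le (ltW s0) d (expR_ge0 _)) _.
  have k0 : 0 < k.+1%:R :> R by [].
  rewrite lee_fin -expRM /harm add0r -[k.+1%:R^-1]lnK ?posrE ?invr_gt0//.
  rewrite lnV ?posrE// /wt -!expRD ler_expR.
  have l0 : 0 <= ln k.+1%:R :> R by rewrite ln_ge0// ler1n.
  have lA : ln k.+1%:R <= f * (m.+1%:R * b) / s.
    rewrite -[leRHS]expRK ler_ln ?posrE ?expR_gt0//.
    by move: kA; congr (_ <= expR _); rewrite /ab; ring.
  have := exponent_le (mulr_gt0 (ltr0Sn _ m) hb) l0 lA.
  have /andP[+ _] := lc_cat (R := R) wu wk; rewrite {2}/lc cont1.
  set l := ln _; set L := lc (u ++ _) => h1 h2.
  have h3 : s * (lc u + l) <= s * L by rewrite ler_pM2l.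
  by lra.
Qed.

Let tail_const : exists2 C, 0 < C & forall N,
  (\esum_(p in index N) diam_pow s (piece p) <=
    (C * expR (- (N%:R * ((f * b - P) / 2))))%:E)%E.
Proof.
(* Summing [harm] over k gives the linear factor 2 + (m + 1) ab. Half of the gap f b - P absorbs it,
   the other half leaves a geometric series in m. *)
pose eta := (f * b - P) / 2.
have eta0 : 0 < eta by rewrite divr_gt0// subr_gt0.
pose K := 2 + ab + ab / eta.
have K0 : 0 < K by rewrite !addr_gt0// divr_gt0.
have lin m : 2 + m.+1%:R * ab <= K * expR (m%:R * eta).
  have h := expR_ge1Dx (m%:R * eta); have m0 : 0 <= m%:R :> R by [].
  apply: le_trans (_ : K * (1 + m%:R * eta) <= _); last by rewrite ler_pM2l.
  have -> : K * (1 + m%:R * eta) =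
      2 + ab + ab / eta + (2 + ab) * m%:R * eta + m%:R * ab.
    by rewrite /K; field; rewrite gt_eqF.
  have : 0 <= ab / eta by rewrite ltW// divr_gt0.
  have : 0 <= (2 + ab) * m%:R * eta.
    by rewrite mulr_ge0 ?(ltW eta0)// mulr_ge0// addr_ge0// ltW.
  by rewrite -natr1; lra.
pose D := expR (2 * s * ln 2 - f * b) * K.
have D0 : 0 < D by rewrite mulr_gt0// expR_gt0.
have e1 : 0 < 1 - expR (- eta) by rewrite subr_gt0 expR_lt1 oppr_lt0.
exists (D / (1 - expR (- eta))); first by rewrite divr_gt0.
move=> N; rewrite -/eta.
apply: (le_trans (le_esum (@piece_cost N))).
rewrite -(@esum_esum _ _ _ _ _ (fun mu k =>
  (wt s mu.2 * (expR (- (mu.1.+1%:R * (f * b))) * harm k))%:E)); last first.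
  move=> mu k _ _; rewrite lee_fin; apply: mulr_ge0; first exact: wt_ge0.
  by apply: mulr_ge0; [exact: expR_ge0|exact: harm_ge0].
pose g m := expR (- (m.+1%:R * (f * b))) * (2 + m.+1%:R * ab).
have g0 m : 0 <= g m.
  by rewrite mulr_ge0 ?expR_ge0// addr_ge0// mulr_ge0// ltW.
apply: (@le_trans _ _ (\esum_(mu in [set m | (N <= m)%N] `*`` @words)
    (g mu.1 * wt s mu.2)%:E)%E).
  apply: le_esum => -[m u] /= _.
  under eq_esum => k _ do rewrite mulrA EFinM.
  rewrite esumZl; last 2 first.
  - by rewrite mulr_ge0 ?expR_ge0.
  - by move=> k _; rewrite lee_fin harm_ge0.
  have x1 : 1 <= expR (m.+1%:R * ab) by rewrite -expR0 ler_expR mulr_ge0// ltW.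
  apply: le_trans (lee_wpmul2l _ (harm_sum x1)) _.
    by rewrite lee_fin mulr_ge0 ?expR_ge0.
  by rewrite -EFinM expRK lee_fin /g; lra.
rewrite -(@esum_esum _ _ _ _ _ (fun m u => (g m * wt s u)%:E)); last first.
  by move=> m u _ _; rewrite lee_fin mulr_ge0 ?expR_ge0.
apply: (@le_trans _ _ (\esum_(m in [set m | (N <= m)%N])
    (D%:E * (expR (- (m%:R * eta)))%:E))%E).
  apply: le_esum => m _; under eq_esum => u _ do rewrite EFinM.
  rewrite esumZl//; last by move=> u _; rewrite lee_fin wt_ge0.
  have [_ h] := hP m; apply: le_trans (lee_wpmul2l _ h) _; first by rewrite lee_fin.
  rewrite -EFinM -EFinM lee_fin /g mulrAC -expRD.
  apply: le_trans (ler_wpM2l (expR_ge0 _) (lin m)) _.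
  have -> : D * expR (- (m%:R * eta)) =
      K * (expR (2 * s * ln 2 - f * b) * expR (- (m%:R * eta))) by rewrite /D; ring.
  rewrite mulrCA ler_pM2l// -!expRD ler_expR.
  by rewrite -natr1 /eta; lra.
rewrite esumZl ?(ltW D0)//.
apply: le_trans (lee_wpmul2l _ (geometric_tail N eta0)) _.
  by rewrite lee_fin ltW.
by rewrite -EFinM lee_fin mulrA mulrAC.
Qed.

Let cover Psi N0 N : (forall n, (N0 <= n)%N -> expR (n%:R * b) <= Psi n) ->
  E_t t0 t1 Psi `<=` \bigcup_(p in index N) piece p.
Proof.
move=> hPsi x [xi xinf].
(* The time is n = m + 1, with m >= N and n >= N0. *)
have [[|m]] := (infinite_natP _).1 xinf (N0 + N.+1)%N; first by rewrite addnS.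
rewrite addnS ltnS => Nm [_ hm].
have N0m : (N0 <= m.+1)%N by rewrite (leq_trans _ (leqW Nm))// leq_addr.
have {}Nm : (N <= m)%N := leq_trans (leq_addl _ _) Nm.
have {hm} := le_trans (hPsi _ N0m) hm.
have [a0 aE] := digitE m xi; have [a'0 a'E] := digitE m.+1 xi.
rewrite aE a'E -!pmulrn; set a := digit m x in a0 aE *.
set a' := digit m.+1 x in a'0 a'E * => hm.
have aR : 0 < a%:R :> R by rewrite ltr0n.
have aR' : 0 < a'%:R :> R by rewrite ltr0n.
have {}hm : m.+1%:R * b <= t0 * ln a%:R + t1 * ln a'%:R.
  have p0 : 0 < a%:R `^ t0 by rewrite powR_gt0.
  have p1 : 0 < a'%:R `^ t1 by rewrite powR_gt0.
  rewrite -!ln_powR -lnM ?posrE// -[leLHS]expRK.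
  by rewrite ler_ln ?posrE ?expR_gt0 ?mulr_gt0.
have wu := word_digits m xi; have szu := size_mkseq (digit^~ x) m.
have y01 := irr01_itv (iter_irr01 m xi); have z01 := irr01_itv (iter_irr01 m.+1 xi).
have invE n : (0 < digit n x)%N -> iter n gauss x <= (digit n x)%:R^-1.
  move=> d0; rewrite iter_gaussS// lef_pV2 ?posrE ?ltr0n//.
    by rewrite lerDl; have /andP[] := irr01_itv (iter_irr01 n.+1 xi).
  by rewrite ltr_wpDr ?ltr0n//; have /andP[] := irr01_itv (iter_irr01 n.+1 xi).
have [aA|aA] := lerP a%:R (expR (m.+1%:R * ab)).
- have [k ak] : exists k, a = k.+1 by exists a.-1; rewrite prednK.
  exists (m, mkseq (digit^~ x) m, k.+1); first by split=> //=; rewrite -ak.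
  rewrite /piece -ak; exists (iter m.+1 gauss x); last first.
    by rewrite -[RHS](cfrac_digits m.+1 xi) mkseqS cats1.
  split=> //; apply: (le_trans (invE m.+1 a'0)).
  rewrite -[_^-1]lnK ?posrE ?invr_gt0// ler_expR lnV ?posrE// lerN2.
  by rewrite ler_pdivrMr// mulrC; lra.
- exists (m, mkseq (digit^~ x) m, 0%N) => /=.
    by split=> //=; rewrite expR_ge0.
  exists (iter m gauss x); last exact: cfrac_digits.
  split=> //; apply: (le_trans (invE m a0)).
  by rewrite expRN lef_pV2 ?posrE ?expR_gt0// ltW.
Qed.

Lemma hausdorff_upper Psi :
  (exists N0, forall n, (N0 <= n)%N -> expR (n%:R * b) <= Psi n) ->
  hausdorff_measure s (E_t t0 t1 Psi) = 0%E.
Proof.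
move=> [N0 hPsi]; have [C C0 tailC] := tail_const.
have eta0 : 0 < (f * b - P) / 2 by rewrite divr_gt0// subr_gt0.
have content0 d : 0 < d -> hausdorff_content s d (E_t t0 t1 Psi) = 0%E.
  move=> d0; apply/eqP; rewrite eq_le; apply/andP; split; last first.
    apply: le_ereal_inf_tmp => _ [U _ <-].
    by apply: nneseries_ge0 => i _ _; exact: diam_pow_ge0.
  apply/lee_addgt0Pr => e e0; rewrite add0e.
  have [N1 hN1] := expR_small eta0 (divr_gt0 e0 C0).
  have [N2 hN2] := expR_small ln2_gt0 d0.
  (* [N1] makes the total cost at most e, and [N2] the diameters at most d; the additional 1 comes
     from [lc_ge_linear]. *)
  pose N := (N1 + N2.+1)%N.
  apply: hausdorff_content_countable (cover N hPsi) _ _.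
  - move=> [[m u] k] [/= [Nm [wu su]] _].
    suff : (diam (piece (m, u, k)) <= (expR (- (2 * lc u)))%:E)%E.
      move=> h; apply: (le_trans h); rewrite lee_fin.
      apply: le_trans (hN2 N2 (leqnn _)).
      rewrite ler_expR lerN2; apply: le_trans (lc_ge_linear wu).
      rewrite ler_pM2r ?ln2_gt0// su lerBrDr natr1 ler_nat.
      by apply: leq_trans Nm; rewrite leq_addl.
    case: k => [|k]; first exact: (diam_cfrac _ wu).2.
    have wk : word [:: k.+1] by [].
    have wuk : word (u ++ [:: k.+1]) by rewrite word_cat wu.
    apply: le_trans (diam_cfrac _ wuk).2 _; rewrite lee_fin ler_expR lerN2 ler_pM2l//.
    have /andP[+ _] := lc_cat (R := R) wu wk; apply: le_trans.
    by rewrite lerDl lc_ge0.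
  - apply: (le_trans (tailC N)); rewrite lee_fin mulrC -ler_pdivlMr//.
    by apply: hN1; rewrite leq_addr.
rewrite /hausdorff_measure (_ : [set _ | _ in _] = [set 0%E]) ?ereal_sup1//.
apply/seteqP; split=> [_ [d d0 <-]|_ ->] /=; first by rewrite content0.
by exists 1; rewrite /= ?content0.
Qed.

End UpperBound.

(** * Lower bound *)

Section Descent.
Context {R : realType}.
Implicit Types (x y t d m : R) (u v w : seq nat) (k n : nat).

(* One step of the descent: a set hitting several children is charged with the
   mass of all of them, so that the chosen child is hit by no such set. *)
Lemma descent_step (T : eqType) (r : seq T) (mass : T -> R)
    (hit0 : pred nat) (hit : T -> pred nat) (c : nat -> R) :
  (forall a, 0 <= mass a) -> (forall i, 0 <= c i) ->
  (forall a i, hit a i -> hit0 i) ->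
  (forall i, (1 < count (hit^~ i) r)%N -> \sum_(a <- r | hit a i) mass a <= c i) ->
  (\sum_(0 <= i <oo) (if hit0 i then (c i)%:E else 0) < (\sum_(a <- r) mass a)%:E)%E ->
  exists2 a, a \in r &
    (\sum_(0 <= i <oo) (if hit a i then (c i)%:E else 0) < (mass a)%:E)%E.
Proof.
move=> m0 c0 hit_sub multi lt0.
pose g a i : R := if hit a i then
  (if (1 < count (hit^~ i) r)%N then mass a else c i) else 0.
have g0 a i : (0 <= (g a i)%:E)%E by rewrite lee_fin /g; do 2?case: ifP.
have gsum i : (\sum_(a <- r) (g a i)%:E <= if hit0 i then (c i)%:E else 0)%E.
  rewrite sumEFin /g -big_mkcond/=; have [hi|hi] := boolP (hit0 i); last first.
    by rewrite big_pred0// => a; apply: contraNF hi; exact: hit_sub.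
  rewrite lee_fin; case: ltnP => [|le1]; first exact: multi.
  by rewrite big_const_seq iter_addr_0 -[leRHS]mulr1n ler_wpMn2l.
have [a ar lta] : exists2 a, a \in r & (\sum_(0 <= i <oo) (g a i)%:E < (mass a)%:E)%E.
  apply: contrapT => h; move: lt0; rewrite ltNge => /negP; apply.
  apply: (@le_trans _ _ (\sum_(a <- r) \sum_(0 <= i <oo) (g a i)%:E)%E).
    rewrite -sumEFin big_seq [leRHS]big_seq; apply: lee_sum => a ar.
    by rewrite leNgt; apply/negP => lta; apply: h; exists a.
  rewrite -nneseries_sum//.
  apply: lee_nneseries; first by move=> j _ _; rewrite sume_ge0.
  by move=> j _; exact: gsum.
exists a => //; apply: (le_lt_trans _ lta); apply: lee_nneseries => [i _ _|i _].
  by case: ifP => // _; rewrite lee_fin.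
have h : ((g a i)%:E <= \sum_(0 <= j <oo) (g a j)%:E)%E.
  rewrite nneseries_esumT//.
  by apply: (@esum_ge_term _ _ _ (fun j => (g a j)%:E)).
have := le_lt_trans h lta; rewrite lte_fin /g; case: ifP => // hi.
by case: ifP => //; rewrite ltxx.
Qed.

Definition cyl u : set R := cfrac u @` [set t | 0 <= t <= 1].

Lemma cyl_cat u v : word v -> cyl (u ++ v) `<=` cyl u.
Proof.
by move=> wv _ [t t01 <-]; exists (cfrac v t); [exact: cfrac_itv|rewrite cfrac_cat].
Qed.

Lemma cfrac_pos_bound v : word v ->
  exists2 d, 0 < d & forall t, 2^-1 <= t <= 1 -> d <= (cfrac v t : R).
Proof.
case: v => [_|k v /= /andP[k0 wv]]; first by exists 2^-1 => // t /andP[].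
have k1 : 0 < k%:R :> R by rewrite ltr0n.
exists (k%:R + 1)^-1; first by rewrite invr_gt0 addr_gt0.
move=> t /andP[t0 t1]; have /andP[c0 c1] : 0 <= (cfrac v t : R) <= 1.
  by apply: cfrac_itv => //; rewrite t1 andbT (le_trans _ t0).
by rewrite lef_pV2 ?posrE; lra.
Qed.

(** Neighbouring cylinders share end points, so the tails are kept in [1/2, 1]. At the first
    differing digits k < l the numerator l - k + y - x is at least y, which [cfrac_pos_bound] keeps
    away from 0; equal digits before shrink the gap by a bounded factor. *)
Lemma words_gap v w : word v -> word w -> size v = size w -> v != w ->
  exists2 d, 0 < d & forall t t', 2^-1 <= t <= 1 -> 2^-1 <= t' <= 1 ->
    d <= `|cfrac v t - cfrac w t' : R|.
Proof.
have half t : 2^-1 <= t <= 1 -> 0 <= t <= 1.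
  by move=> /andP[h ->]; rewrite andbT (le_trans _ h).
have gap1 (k l : nat) v' w' : (0 < k)%N -> (k < l)%N -> word v' -> word w' ->
    exists2 d, 0 < d & forall t t', 2^-1 <= t <= 1 -> 2^-1 <= t' <= 1 ->
    d <= `|cfrac (k :: v') t - cfrac (l :: w') t' : R|.
  move=> k0 kl wv ww; have [d d0 hd] := cfrac_pos_bound ww.
  have k1 : 0 < k%:R :> R by rewrite ltr0n.
  have kl1 : k%:R + 1 <= l%:R :> R by rewrite natr1 ler_nat.
  exists (d / ((k%:R + 1) * (l%:R + 1))).
    by rewrite divr_gt0// mulr_gt0// addr_gt0// (lt_le_trans _ kl1)// addr_gt0.
  move=> t t' ht ht'; have /andP[c0 c1] := cfrac_itv wv (half _ ht).
  have /andP[e0 e1] := cfrac_itv ww (half _ ht'); have := hd _ ht'.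
  rewrite /=; set x := cfrac v' t in c0 c1 *; set y := cfrac w' t' in e0 e1 *.
  move=> dy; have -> : (k%:R + x)^-1 - (l%:R + y)^-1 =
      (l%:R - k%:R + y - x) / ((k%:R + x) * (l%:R + y)).
    by field; rewrite !gt_eqF//; lra.
  have p0 : 0 < (k%:R + x) * (l%:R + y) by rewrite mulr_gt0//; lra.
  rewrite ger0_norm; last by rewrite divr_ge0// ?(ltW p0)//; lra.
  apply: ler_pM; [exact: ltW | by rewrite invr_ge0 mulr_ge0//; lra | lra |].
  by rewrite lef_pV2 ?posrE// ?mulr_gt0//; try lra; apply: ler_pM; lra.
elim: v w => [|k v IH] [|l w] //= /andP[k0 wv] /andP[l0 ww] [szE] vw.
have [klt|klt|kl] := ltngtP k l.
- exact: gap1.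
- have [d d0 hd] := gap1 _ _ _ _ l0 klt ww wv.
  by exists d => // t t' ht ht'; rewrite distrC; apply: hd.
- rewrite -{}kl in vw *.
  have {}vw : v != w by apply: contraNneq vw => ->.
  have [d d0 hd] := IH w wv ww szE vw.
  have k1 : 0 < k%:R :> R by rewrite ltr0n.
  exists (d / ((k%:R + 1) * (k%:R + 1))).
    by rewrite divr_gt0// !mulr_gt0// addr_gt0.
  move=> t t' ht ht'; have /andP[c0 c1] := cfrac_itv wv (half _ ht).
  have /andP[e0 e1] := cfrac_itv ww (half _ ht'); have := hd _ _ ht ht'.
  set x := cfrac v t in c0 c1 *; set y := cfrac w t' in e0 e1 *.
  move=> dxy; have -> : (k%:R + x)^-1 - (k%:R + y)^-1 =
      (y - x) / ((k%:R + x) * (k%:R + y)) by field; rewrite !gt_eqF//; lra.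
  have p0 : 0 < (k%:R + x) * (k%:R + y) by rewrite mulr_gt0//; lra.
  rewrite normrM distrC normfV (ger0_norm (ltW p0)).
  apply: ler_pM; [exact: ltW | by rewrite invr_ge0 mulr_ge0//; lra | done |].
  by rewrite lef_pV2 ?posrE// ?mulr_gt0//; try lra; apply: ler_pM; lra.
Qed.

Lemma finite_positive_bound (T : eqType) (r : seq T) (Q : T -> R -> Prop) :
  (forall a d d', d' <= d -> Q a d -> Q a d') ->
  (forall a, a \in r -> exists2 d, 0 < d & Q a d) ->
  exists2 d, 0 < d & forall a, a \in r -> Q a d.
Proof.
move=> mono; elim: r => [|a r IH] h; first by exists 1.
have [d d0 hd] := h a (mem_head _ _).
have [|d' d'0 hd'] := IH; first by move=> b br; apply: h; rewrite inE br orbT.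
exists (Num.min d d'); first by rewrite lt_min d0.
move=> b; rewrite inE => /predU1P[->|/hd'].
  by apply: mono hd; rewrite ge_min lexx.
by apply: mono; rewrite ge_min lexx orbT.
Qed.

Lemma words_family_gap (W : seq (seq nat)) n : (forall w, w \in W -> words n w) ->
  exists2 d, 0 < d & forall v w t t', v \in W -> w \in W -> v != w ->
    2^-1 <= t <= 1 -> 2^-1 <= t' <= 1 -> d <= `|cfrac v t - cfrac w t' : R|.
Proof.
move=> hW; pose Q (p : seq nat * seq nat) d := p.1 != p.2 ->
  forall t t', 2^-1 <= t <= 1 -> 2^-1 <= t' <= 1 ->
  d <= `|cfrac p.1 t - cfrac p.2 t' : R|.
have [|p|d d0 hd] := @finite_positive_bound _ [seq (v, w) | v <- W, w <- W] Q.
- by move=> p d d' dd' h pn t t' ht ht'; apply: le_trans dd' _; apply: h.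
- move=> /allpairsP[[v w] /= [/hW[wv sv] /hW[ww sw] ->]].
  have [<-|vw] := eqVneq v w; first by exists 1 => //; rewrite /Q eqxx.
  have svw : size v = size w by rewrite sv.
  by have [d d0 h] := words_gap wv ww svw vw; exists d => // _; exact: h.
exists d => // v w t t' vW wW vw; apply: (hd (v, w)) => //.
by apply/allpairsP; exists (v, w).
Qed.

Lemma cyl_11 u x : cyl (u ++ [:: 1; 1]%N) x ->
  exists2 t, 2^-1 <= t <= 1 & x = cfrac u t.
Proof.
move=> [t /= /andP[t0 t1] <-]; rewrite cfrac_cat.
exists (cfrac [:: 1; 1]%N t) => //=.
have h1 : 0 <= (1 + t)^-1 <= 1 by rewrite invr_ge0 invf_le1; lra.
by move: h1 => /andP[h1 h2]; rewrite lef_pV2 ?posrE ?invf_le1; lra.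
Qed.

(** A set that meets k + 1 equally spaced children must stretch over k spacings. *)
Lemma count_spread (Q : pred nat) n k : count Q (iota 0 n) = k.+1 ->
  exists i j, [/\ Q i, Q j, (i + k <= j)%N & (j < n)%N].
Proof.
elim: n k => // n IH k; rewrite -addn1 iotaD add0n count_cat /= addn0.
have [Qn|_] := boolP (Q n); last first.
  rewrite addn0 => /IH[i [j [Qi Qj ij jn]]].
  by exists i, j; split; rewrite // addn1 ltnS ltnW.
rewrite (addn1 (count _ _)) => -[]; case: k => [_|k cE].
  by exists n, n; rewrite addn0 addn1.
have [i [j [Qi Qj ij jn]]] := IH _ cE.
exists i, n; split; rewrite ?addn1// addnS.
exact: leq_ltn_trans ij jn.
Qed.

End Descent.

(** * Points with prescribed digits *)

Section InfiniteFractions.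
Context {R : realType}.
Implicit Types (x y t d : R) (u v w : seq nat) (k m n : nat).

(** [cfrac u] increases or decreases according to the parity of the length of u; unordered
    betweenness avoids this distinction. *)
Let between x y t := y <= x <= t \/ t <= x <= y.

Let between_inv k x y t : (0 < k)%N -> 0 <= x -> 0 <= y -> 0 <= t -> between x y t ->
  between (k%:R + x)^-1 (k%:R + y)^-1 (k%:R + t)^-1.
Proof.
move=> k0 x0 y0 t0; have k1 : 0 < k%:R :> R by rewrite ltr0n.
by case=> /andP[h1 h2]; [right|left]; rewrite !lef_pV2 ?posrE ?ltr_wpDr// !lerD2l h1 h2.
Qed.

Let cyl_between u x : word u -> cyl u x -> between x (cfrac u 0) (cfrac u 1).
Proof.
move=> wu [t t01 <-]; elim: u wu => [_|k u IH /= /andP[k0 wu]]; first by left.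
have [c0 _] := andP (cfrac_itv wu t01).
have [c1 _] := andP (@cfrac_itv R u 0 wu (introT andP (conj (lexx 0) ler01))).
have [c2 _] := andP (@cfrac_itv R u 1 wu (introT andP (conj ler01 (lexx 1)))).
exact: between_inv (IH wu).
Qed.

Let between_cyl u x : word u -> between x (cfrac u 0) (cfrac u 1) -> cyl u x.
Proof.
elim: u x => [|k u IH] x.
  move=> _ [x01|/andP[h1 h2]]; first by exists x.
  by exists x => //=; rewrite /cfrac /= in h1 h2; lra.
move=> /= /andP[k0 wu] xb.
have k1 : 0 < k%:R :> R by rewrite ltr0n.
have [c1 d1] := andP (@cfrac_itv R u 0 wu (introT andP (conj (lexx 0) ler01))).
have [c2 d2] := andP (@cfrac_itv R u 1 wu (introT andP (conj ler01 (lexx 1)))).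
have e1 : 0 < (k%:R + cfrac u 0)^-1 :> R by rewrite invr_gt0 ltr_wpDr.
have e2 : 0 < (k%:R + cfrac u 1)^-1 :> R by rewrite invr_gt0 ltr_wpDr.
have x0 : 0 < x by case: xb => /andP[h _]; apply: lt_le_trans h.
have [t t01 tE] : cyl u (x^-1 - k%:R).
  apply: IH => //; case: xb => /andP[h1 h2]; [right|left].
  - rewrite lerBrDl lerBlDl -[X in X <= x^-1]invrK lef_pV2 ?posrE// h2/=.
    by rewrite -[leRHS]invrK lef_pV2 ?posrE.
  - rewrite lerBrDl lerBlDl -[X in X <= x^-1]invrK lef_pV2 ?posrE// h2/=.
    by rewrite -[leRHS]invrK lef_pV2 ?posrE.
by exists t => //=; rewrite tE addrC subrK invrK.
Qed.

Lemma cyl_mkseq (a : nat -> nat) m n : (forall i, (0 < a i)%N) -> (m <= n)%N ->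
  (cyl (mkseq a n) : set R) `<=` cyl (mkseq a m).
Proof.
move=> a0 /subnKC <-; elim: (n - m)%N => [|k IH]; first by rewrite addn0.
rewrite addnS mkseqS -cats1; apply: subset_trans IH; apply: cyl_cat.
by rewrite /= a0.
Qed.

Lemma word_mkseq (a : nat -> nat) n : (forall i, (0 < a i)%N) -> word (mkseq a n).
Proof. by move=> a0; apply/allP => _ /mapP[i _ ->]. Qed.

Let nested_point (a : nat -> nat) : (forall i, (0 < a i)%N) ->
  exists x, forall n, cyl (mkseq a n) x.
Proof.
move=> a0; pose l n : R := Num.min (cfrac (mkseq a n) 0) (cfrac (mkseq a n) 1).
pose h n : R := Num.max (cfrac (mkseq a n) 0) (cfrac (mkseq a n) 1).
have lh n x : cyl (mkseq a n) x -> l n <= x <= h n.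
  move=> /(cyl_between (word_mkseq n a0)); rewrite /l /h ge_min le_max.
  by case=> /andP[-> ->]; rewrite ?orbT.
have lmhn m n : l m <= h n.
  have c : cyl (mkseq a (maxn m n)) (cfrac (mkseq a (maxn m n)) 0 : R).
    by exists 0 => //=; rewrite lexx ler01.
  have /lh/andP[h1 _] := cyl_mkseq a0 (leq_maxl m n) c.
  have /lh/andP[_ h2] := cyl_mkseq a0 (leq_maxr m n) c.
  exact: le_trans h1 h2.
have supA : has_sup (range l).
  by split; [exists (l 0%N); exists 0%N|exists (h 0%N) => _ [n _ <-]].
exists (sup (range l)) => n; apply: between_cyl; first exact: word_mkseq.
have h1 : l n <= sup (range l) by apply: ub_le_sup; [case: supA|exists n].
have h2 : sup (range l) <= h n.
  by apply: sup_le_ub; [case: supA|move=> _ [m _ <-]].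
move: h1 h2; rewrite /l /h /between.
by case: (leP (cfrac (mkseq a n) 0) (cfrac (mkseq a n) 1)) => _ -> ->; [left|right].
Qed.

Lemma infinite_cfrac (a : nat -> nat) : (forall i, (0 < a i)%N) ->
  exists x, [/\ irr01 x, forall n, digit n x = a n & forall n, cyl (mkseq a n) x].
Proof.
move=> a0; have [x hx] := nested_point a0.
(* [t n] is the n-th tail of x; [tS] is its recursion, obtained from the injectivity of [cfrac]. *)
pose t n : R := projT1 (cid2 (hx n)).
have tP n : 0 <= t n <= 1 /\ cfrac (mkseq a n) (t n) = x by rewrite /t; case: cid2.
have aR n : 1 <= (a n)%:R :> R by rewrite ler1n.
have tS n : t n = ((a n)%:R + t n.+1)^-1.
  have [t01 tE] := tP n; have [s01 sE] := tP n.+1.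
  apply: (cfrac_inj (word_mkseq n a0)); rewrite ?in_itv//=.
    have /andP[s0 _] := s01; have := aR n.
    by move=> h; rewrite invr_ge0 invf_le1; lra.
  by rewrite tE -sE mkseqS -cats1 cfrac_cat.
have t0 n : 0 < t n.
  have [/andP[s0 _] _] := tP n.+1; rewrite tS invr_gt0 ltr_wpDr//.
  exact: lt_le_trans ltr01 (aR n).
have t1 n : t n < 1.
  by have h := t0 n.+1; have h' := aR n; rewrite tS invf_lt1; lra.
(* A rational tail p / q would make the next tail rational with the smaller
   denominator p. *)
have notfrac q : forall n p, (0 < q)%N -> t n <> p%:R / q%:R.
  have [N] := ubnP q; elim: N q => // N IH q; rewrite ltnS => qN n p q0 tE.
  have qR : 0 < q%:R :> R by rewrite ltr0n.
  have p0 : (0 < p)%N.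
    by rewrite lt0n; apply/eqP => pE; have := t0 n; rewrite tE pE mul0r ltxx.
  have pq : (p < q)%N by have := t1 n; rewrite tE ltr_pdivrMr// mul1r ltr_nat.
  have pR : 0 < p%:R :> R by rewrite ltr0n.
  have tE' : t n.+1 = (q%:R - (a n)%:R * p%:R) / p%:R.
    have : (t n)^-1 = (a n)%:R + t n.+1 by rewrite tS invrK.
    by rewrite tE invf_div mulrBl mulfK ?gt_eqF// => ->; ring.
  have ap : (a n * p <= q)%N.
    have := t0 n.+1; rewrite tE' pmulr_lgt0 ?invr_gt0// subr_gt0 -natrM ltr_nat.
    exact: ltnW.
  by apply: (IH p (leq_trans pq qN) n.+1 (q - a n * p)%N p0); rewrite tE' natrB// natrM.
have tirr n : irr01 (t n).
  split; first by rewrite /= t1 ltW.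
  move=> /rationalP[p [q tE]]; have q0 : (0 < q)%N.
    by rewrite lt0n; apply/eqP => qE; have := t0 n; rewrite tE qE invr0 mulr0 ltxx.
  have p0 : 0 <= p.
    have : 0 < p%:~R * q%:R^-1 :> R by rewrite -tE t0.
    by rewrite pmulr_lgt0 ?invr_gt0 ?ltr0n// ltr0z => /ltW.
  by apply: (notfrac q n `|p|%N q0); rewrite tE -[in LHS](gez0_abs p0) -pmulrn.
exists x; split=> //; first by have [_ <-] := tP 0%N; exact: tirr.
move=> n; have [_ <-] := tP n.+1; rewrite mkseqS -cats1.
have := @digit_cfrac R _ _ [::] _ (word_mkseq n a0) (a0 n) isT (tirr n.+1).
by rewrite size_mkseq.
Qed.

End InfiniteFractions.

(** * The descent in the tree of words *)

Section LowerBound.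
Context {R : realType}.
Variables (s lam delta : R) (W : seq (seq nat)) (l : nat).
Hypotheses (hs : 0 < s < 1) (hlam : 0 < lam) (hdelta : 0 < delta).
Hypotheses (W_uniq : uniq W) (W_words : forall w, w \in W -> words l w).
Hypothesis W_sum : expR (6 * s * ln 2 + l.+2%:R * lam) <= \sum_(w <- W) wt s w.
Hypothesis W_gap : forall v w t t', v \in W -> w \in W -> v != w ->
  2^-1 <= t <= 1 -> 2^-1 <= t' <= 1 -> delta <= `|cfrac v t - cfrac w t' : R|.
Variables (U : nat -> set R) (c : nat -> R).
Hypothesis c_gt0 : forall i, 0 < c i.
Hypothesis c_dist : forall i x y, U i x -> U i y -> `|x - y| `^ s <= c i.
Implicit Types (x y t e m : R) (u v w : seq nat) (k n M : nat).

Let s0 : 0 < s. Proof. by case/andP: hs. Qed.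
Let s1 : s < 1. Proof. by case/andP: hs. Qed.

Let hit u : pred nat := fun i => `[< U i `&` cyl u !=set0 >].
(* The cost of the sets that meet the cylinder of [u]. *)
Let load u : \bar R := (\sum_(0 <= i <oo) (if hit u i then (c i)%:E else 0))%E.

Let hit_cat u v i : word v -> hit (u ++ v) i -> hit u i.
Proof.
move=> wv /asboolP[x [Ux xu]]; apply/asboolP; exists x.
by split=> //; exact: cyl_cat xu.
Qed.

Let load_cat u v : word v -> (load (u ++ v) <= load u)%E.
Proof.
move=> wv; apply: lee_nneseries => [i _ _|i _].
  by case: ifP => // _; rewrite lee_fin ltW.
case: ifP => [/(hit_cat wv) ->//|_].
by case: ifP => // _; rewrite lee_fin ltW.
Qed.

Let sep_cost i x y e : U i x -> U i y -> expR e <= `|x - y| -> expR (e * s) <= c i.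
Proof.
move=> Ux Uy xy; apply: le_trans (c_dist Ux Uy).
by rewrite expRM ge0_ler_powR ?nnegrE ?expR_ge0// ltW.
Qed.

(** [descent_step] asks that hitting a child implies hitting the parent for all labels, even outside
    r; the test [word (child a)] ensures this. *)
Let child_step (T : eqType) (r : seq T) (child : T -> seq nat) (mass : T -> R) u :
  (forall a, a \in r -> word (child a)) -> (forall a, 0 <= mass a) ->
  (forall i, (1 < count (fun a => word (child a) && hit (u ++ child a) i) r)%N ->
    \sum_(a <- r | word (child a) && hit (u ++ child a) i) mass a <= c i) ->
  (load u < (\sum_(a <- r) mass a)%:E)%E ->
  exists2 a, a \in r & (load (u ++ child a) < (mass a)%:E)%E.
Proof.
move=> wr mass0 multi lt0; pose h a i := word (child a) && hit (u ++ child a) i.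
have [||a ar la] := @descent_step R T r mass (hit u) h c mass0 _ _ multi lt0.
- by move=> i; rewrite ltW.
- by move=> a i /andP[]; exact: hit_cat.
exists a => //; move: la; rewrite /load.
by under eq_eseriesr => i _ do rewrite /h (wr a ar).
Qed.

(* [mu] is the logarithm of the mass of the current cylinder; the invariant is
   mass * q(u)^(2s) <= e^kappa, where kappa comes from the gap [delta]. *)
Let kappa := (ln delta - 2 * ln 2) * s.

Let count2 (T : eqType) (r : seq T) (Q : pred T) : uniq r -> (1 < count Q r)%N ->
  exists a b, [/\ a \in r, b \in r, Q a, Q b & a != b].
Proof.
move=> /(filter_uniq Q); rewrite -size_filter.
case E : (seq.filter Q r) => [|a [|b q]]//= /andP[abq _] _; exists a, b.
have : a \in seq.filter Q r by rewrite E mem_head.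
have : b \in seq.filter Q r by rewrite E !inE eqxx orbT.
rewrite !mem_filter => /andP[-> ->] /andP[-> ->]; split=> //.
by apply: contraNneq abq => ->; rewrite mem_head.
Qed.

Let dist_ge u t t' e : word u -> 0 <= t <= 1 -> 0 <= t' <= 1 ->
  expR (e + 2 * ln 2 + 2 * lc u) <= `|t - t'| ->
  expR e <= `|cfrac u t - cfrac u t'|.
Proof.
move=> wu t01 t01' h; apply: le_trans (cfrac_dist_ge wu t01 t01').
have q0 := cont_gt0 (R := R) wu.
rewrite ler_pdivlMr ?mulr_gt0 ?exprn_gt0//; apply: le_trans h.
by rewrite !expRD !expRM_natl expR_lc// lnK ?posrE// mulrA -natrX.
Qed.

(* The suffix 1 1 keeps the tails in [1/2, 2/3], hence the children apart. *)
Let block_step u mu : word u -> mu + 2 * s * lc u <= kappa ->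
  (load u < (expR mu)%:E)%E ->
  exists v mu', [/\ words l.+2 v, (load (u ++ v) < (expR mu')%:E)%E &
    mu' + 2 * s * lc (u ++ v) <= mu + 2 * s * lc u - l.+2%:R * lam].
Proof.
move=> wu hmu lu; pose Z : R := \sum_(w <- W) wt s w.
have Z0 : 0 < Z by apply: lt_le_trans W_sum; exact: expR_gt0.
pose mass w := expR mu * (wt s w / Z).
have massE : \sum_(w <- W) mass w = expR mu.
  by rewrite -big_distrr -big_distrl /= -/Z divff ?mulr1 ?gt_eqF.
have mass0 w : 0 <= mass w by rewrite mulr_ge0 ?divr_ge0 ?expR_ge0 ?(ltW Z0).
have w11 : word [:: 1; 1]%N by [].
have [|i ci||w wW lw] := @child_step _ W (fun w => w ++ [:: 1; 1]%N) mass u _ mass0 _ _.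
- by move=> w /W_words[ww _]; rewrite word_cat ww.
- have [v [w [vW wW /andP[_ /asboolP[x [Ux xv]]] /andP[_ /asboolP[y [Uy yw]]] vw]]] :=
    count2 W_uniq ci.
  apply: (@le_trans _ _ (expR mu)).
    rewrite -massE [leLHS]big_mkcond; apply: ler_sum => z _.
    by case: ifP => // _; exact: mass0.
  move: xv yw; rewrite !catA => /cyl_11[t ht xE] /cyl_11[t' ht' yE].
  have half z : 2^-1 <= z <= 1 -> 0 <= z <= 1.
    by move=> /andP[h ->]; rewrite andbT (le_trans _ h).
  have [wv _] := W_words vW; have [ww _] := W_words wW.
  (* [cfrac u] shrinks the gap [delta] by a factor at most 4 q(u)^2; by the choice of [kappa], the
     power s of the result is at least the whole mass. *)
  have xy : expR (ln delta - 2 * ln 2 - 2 * lc u) <= `|x - y|.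
    rewrite xE yE !cfrac_cat.
    apply: dist_ge => //; try by apply: cfrac_itv => //; exact: half.
    have -> : ln delta - 2 * ln 2 - 2 * lc u + 2 * ln 2 + 2 * lc u = ln delta by ring.
    by rewrite lnK ?posrE//; exact: W_gap.
  apply: le_trans (sep_cost Ux Uy xy); rewrite ler_expR.
  by move: hmu; rewrite /kappa; lra.
- by rewrite massE.
exists (w ++ [:: 1; 1]%N), (mu - 2 * s * lc w - ln Z).
have [ww sw] := W_words wW.
split; first by split; rewrite ?word_cat ?ww// size_cat sw addn2.
  rewrite (_ : expR _ = mass w)// expRD expRN lnK ?posrE// expRD -mulrA.
  by rewrite /mass /wt.
have wv : word (w ++ [:: 1; 1]%N) by rewrite word_cat ww.
have /andP[_ h1] := lc_cat (R := R) wu wv; have /andP[_ h2] := lc_cat (R := R) ww w11.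
have l11 : lc [:: 1; 1]%N = ln 2 :> R.
  by rewrite /lc /cont /= addr0 !mulr1 invr1.
(* Two concatenations and the continuant 2 of the word 1 1 cost a factor 8 in the continuant, hence
   6 s ln 2 in the exponent. *)
have h3 : 6 * s * ln 2 + l.+2%:R * lam <= ln Z.
  by rewrite -[leLHS]expRK ler_ln ?posrE ?expR_gt0.
have h4 : s * lc (u ++ (w ++ [:: 1; 1]%N)) <= s * (3 * ln 2 + (lc u + lc w)).
  by rewrite ler_pM2l//; move: h1 h2; rewrite l11; lra.
lra.
Qed.

(* The digits M, M + 2, ..., 3M - 2: the spacing 2 keeps the children apart. *)
Let big_step u mu M : word u -> (0 < M)%N ->
  mu + 2 * s * lc u <= - (s * (ln 72 + ln M%:R)) ->
  (load u < (expR mu)%:E)%E ->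
  exists a, [/\ (M <= a < 3 * M)%N,
    (load (u ++ [:: a]) < (expR (mu - ln M%:R))%:E)%E &
    mu - ln M%:R + 2 * s * lc (u ++ [:: a]) <=
      mu + 2 * s * lc u + (2 * s - 1) * ln M%:R + 2 * s * ln 6].
Proof.
move=> wu M0 hmu lu; have MR : 0 < M%:R :> R by rewrite ltr0n.
pose mass (j : nat) : R := expR mu / M%:R.
have mass0 j : 0 <= mass j by rewrite divr_ge0 ?expR_ge0// ltW.
have massE : \sum_(j <- iota 0 M) mass j = expR mu.
  rewrite big_const_seq count_predT size_iota iter_addr_0 -[LHS]mulr_natr.
  by rewrite divfK// gt_eqF.
have [|i ci||j jM lj] :=
  @child_step _ (iota 0 M) (fun j => [:: M + 2 * j]%N) mass u _ mass0 _ _.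
- by move=> j _; rewrite /= addn_gt0 M0.
- set Q := fun j => _ && _ in ci *.
  case kE : (count Q (iota 0 M)) ci => [|k]// k1.
  have [i1 [i2 [Q1 Q2 i12 i2M]]] := count_spread kE.
  have /andP[_ /asboolP[x [Ux [t t01 xE]]]] := Q1.
  have /andP[_ /asboolP[y [Uy [t' t01' yE]]]] := Q2.
  rewrite big_const_seq kE iter_addr_0 -[leLHS]mulr_natl.
  pose K : R := k.+1%:R; have K0 : 0 < K by [].
  have KM : K <= M%:R by rewrite ler_nat -(size_iota 0 M) -kE count_size.
  (* The distance is at least K / (72 M^2 q(u)^2): the digits differ by at least K and the tails by
     at most 1, which leaves K / 2; the denominators are at most 3 M each; and [cfrac u] costs 4
     q(u)^2. *)
  pose e := ln K - ln M%:R - (ln 72 + ln M%:R) - 2 * lc u.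
  have xy : expR e <= `|x - y|.
    move: xE yE; rewrite !cfrac_cat /= => <- <-.
    pose A : R := (M + 2 * i1)%:R; pose B : R := (M + 2 * i2)%:R.
    rewrite -/A -/B; have A1 : M%:R <= A by rewrite ler_nat leq_addr.
    have B1 : B + 1 <= 3 * M%:R.
      have : (M + 2 * i2 + 1 <= 3 * M)%N by clear -i2M; lia.
      by rewrite -(ler_nat R) natrD natrM.
    have AB : A + K <= B.
      have : (M + 2 * i1 + k.+1 <= M + 2 * i2)%N by clear -i12 k1; lia.
      by rewrite -(ler_nat R) [leLHS]natrD.
    have M1 : 1 <= M%:R :> R by rewrite ler1n.
    have K2 : 2 <= K by rewrite ler_nat.
    have /andP[t0 t1] := t01; have /andP[t0' t1'] := t01'.
    have inv01 x' : 1 <= x' -> 0 <= x'^-1 <= 1.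
      by move=> x1; rewrite invr_ge0 invf_le1; lra.
    apply: dist_ge => //; try by apply: inv01; lra.
    have -> : e + 2 * ln 2 + 2 * lc u = ln K + 2 * ln 2 - ln 72 - 2 * ln M%:R.
      by rewrite /e; ring.
    rewrite !expRD !expRN !expRM_natl !lnK ?posrE//.
    have -> : (A + t)^-1 - (B + t')^-1 = (B - A + t' - t) / ((A + t) * (B + t')).
      by field; rewrite !gt_eqF//; lra.
    have p0 : 0 < (A + t) * (B + t') by rewrite mulr_gt0//; lra.
    rewrite ger0_norm; last by rewrite divr_ge0// ?(ltW p0)//; lra.
    rewrite ler_pdivlMr//.
    have h : (A + t) * (B + t') <= (3 * M%:R) * (3 * M%:R) by apply: ler_pM; lra.
    apply: (le_trans (ler_wpM2l _ h)).
      by rewrite !divr_ge0 ?mulr_ge0 ?exprn_ge0 ?(ltW K0) ?(ltW MR).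
    have -> : K * 2 ^+ 2 / 72 / M%:R ^+ 2 * (3 * M%:R * (3 * M%:R)) = K / 2.
      by field; rewrite gt_eqF.
    by lra.
  apply: le_trans (sep_cost Ux Uy xy).
  have -> : K * (expR mu / M%:R) = expR (ln K - ln M%:R + mu).
    by rewrite !expRD expRN !lnK ?posrE//; ring.
  rewrite ler_expR /e.
  (* Since K <= M and s < 1, the share K / M of the mass is at most (K / M)^s. *)
  have lKM : ln K <= ln M%:R by rewrite ler_ln ?posrE.
  have hK : (ln K - ln M%:R) * (1 - s) <= 0.
    by rewrite mulr_le0_ge0 ?subr_le0// subr_ge0 ltW.
  by lra.
- by rewrite massE.
exists (M + 2 * j)%N; move: jM; rewrite mem_iota add0n /= => jM.
have aM : (M <= M + 2 * j < 3 * M)%N by clear -jM; lia.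
split=> //; first by rewrite expRD expRN lnK ?posrE.
have wa : word [:: M + 2 * j]%N by rewrite /= addn_gt0 M0.
have /andP[_ h1] := lc_cat (R := R) wu wa.
have h2 : lc [:: M + 2 * j]%N <= ln 3 + ln M%:R :> R.
  rewrite /lc cont1 -lnM ?posrE// -natrM ler_ln ?posrE ?ltr0n ?addn_gt0 ?muln_gt0 ?M0//.
  by rewrite ler_nat ltnW//; case/andP: aM.
have l6 : ln 6 = ln 2 + ln 3 :> R by rewrite -lnM ?posrE// -natrM.
have h3 : s * lc (u ++ [:: M + 2 * j]%N) <= s * (ln 2 + (lc u + (ln 3 + ln M%:R))).
  by rewrite ler_pM2l//; lra.
by rewrite l6; lra.
Qed.

Let blocks u mu j : word u -> mu + 2 * s * lc u <= kappa ->
  (load u < (expR mu)%:E)%E ->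
  exists v mu', [/\ word v, size v = (j * l.+2)%N,
    (load (u ++ v) < (expR mu')%:E)%E &
    mu' + 2 * s * lc (u ++ v) <= kappa - (j * l.+2)%:R * lam].
Proof.
move=> wu hmu lu; elim: j => [|j [v [mu' [wv sv lv hv]]]].
  by exists [::], mu; rewrite cats0 mul0r subr0.
have wuv : word (u ++ v) by rewrite word_cat wu.
have hv' : mu' + 2 * s * lc (u ++ v) <= kappa.
  by apply: (le_trans hv); rewrite gerBl mulr_ge0// ltW.
have [w [mu'' [[ww sw] lw hw]]] := block_step wuv hv' lv.
exists (v ++ w), mu''; rewrite catA word_cat wv ww size_cat sv sw mulSn addnC.
split=> //.
by rewrite natrD mulrDl; lra.
Qed.

(** A forced digit 1 keeps the mass and does not raise the load; only the continuant grows, by a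
    factor at most 2. *)
Let pads u mu r : word u -> (load u < (expR mu)%:E)%E ->
  (load (u ++ ones r) < (expR mu)%:E)%E /\ lc (u ++ ones r) <= lc u + r%:R * ln 2 :> R.
Proof.
move=> wu lu; have [wr _] := word_ones r.
split; first exact: le_lt_trans (load_cat _ wr) lu.
elim: r {wr} => [|r IH]; first by rewrite cats0 mul0r addr0.
have [wr _] := word_ones r; have wur : word (u ++ ones r) by rewrite word_cat wu.
have -> : ones r.+1 = ones r ++ [:: 1%N] by rewrite /ones -addn1 nseqD.
rewrite catA; have /andP[_] := @lc_cat R _ [:: 1%N] wur isT.
by rewrite {3}/lc cont1 ln1 -natr1; lra.
Qed.

(* Blocks first, then fewer than l + 2 digits 1 to reach the exact length. *)
Let fill u mu N : word u -> mu + 2 * s * lc u <= kappa ->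
  (load u < (expR mu)%:E)%E -> (size u <= N)%N ->
  exists v mu', [/\ word v, size (u ++ v) = N, (load (u ++ v) < (expR mu')%:E)%E &
    mu' + 2 * s * lc (u ++ v) <=
      kappa - N%:R * lam + ((size u)%:R * lam + l.+2%:R * (lam + 2 * s * ln 2))].
Proof.
move=> wu hmu lu uN; pose j := ((N - size u) %/ l.+2)%N.
pose r := ((N - size u) %% l.+2)%N.
have NE : N = (size u + j * l.+2 + r)%N by rewrite -addnA -divn_eq subnKC.
have [v [mu' [wv sv lv hv]]] := blocks j wu hmu lu.
have wuv : word (u ++ v) by rewrite word_cat wu.
have [lr hr] := pads r wuv lv; have [wr sr] := word_ones r.
exists (v ++ ones r), mu'; rewrite catA word_cat wv wr; split=> //.
  by rewrite !size_cat sv sr -NE.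
have h1 : s * lc ((u ++ v) ++ ones r) <= s * (lc (u ++ v) + r%:R * ln 2).
  by rewrite ler_pM2l.
have rl : r%:R <= l.+2%:R :> R by rewrite ler_nat ltnW// ltn_mod.
have h2 : r%:R * (lam + 2 * s * ln 2) <= l.+2%:R * (lam + 2 * s * ln 2).
  by rewrite ler_wpM2r// addr_ge0 ?mulr_ge0 ?(ltW ln2_gt0) ?(ltW s0) ?(ltW hlam).
have NR : N%:R = (size u)%:R + (j * l.+2)%:R + r%:R :> R by rewrite {1}NE !natrD.
by rewrite NR; lra.
Qed.

Variables (t0 t1 b alpha f : R) (Psi : nat -> R).
Hypotheses (ht0 : 0 < t0) (ht1 : 0 < t1) (hb : 0 < b) (f_lam : f * b < lam).
Hypotheses (alpha_ge0 : 0 <= alpha) (alpha_le : t0 * alpha <= 1).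
Hypotheses (alpha_f : s * alpha <= f)
  (alpha_f' : (2 * s - 1) * alpha + s * ((1 - t0 * alpha) / t1) <= f).
Hypothesis Psi_io : forall N, exists2 n, (N <= n)%N & Psi n <= expR (n%:R * b).

Let nat_near_exp (x : R) : 0 <= x ->
  exists2 M, (0 < M)%N & x <= ln M%:R <= x + ln 2.
Proof.
move=> x0; exists (Num.truncn (expR x)).+1 => //.
have ex1 : 1 <= expR x by rewrite -expR0 ler_expR.
have /andP[h1 h2] := truncn_itv (expR_ge0 x).
apply/andP; split.
  by rewrite -[leLHS]expRK ler_ln ?posrE ?expR_gt0// ltW.
rewrite -[x in leRHS]expRK -lnM ?posrE ?expR_gt0// ler_ln ?posrE ?mulr_gt0 ?expR_gt0//.
by rewrite -natr1; lra.
Qed.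

(** Filling up to length n lowers the logarithm of mass times q^(2s) by about n lam. The two large
    digits need at most about f b n of this, and f b < lam, so the invariant holds again for large
    n. *)
Let stage u mu : word u -> mu + 2 * s * lc u <= kappa ->
  (load u < (expR mu)%:E)%E ->
  exists v mu' n, [/\ word v /\ (size u <= n)%N, size (u ++ v) = n.+2,
    Psi n.+1 <= (nth 0%N (u ++ v) n)%:R `^ t0 * (nth 0%N (u ++ v) n.+1)%:R `^ t1,
    (load (u ++ v) < (expR mu')%:E)%E & mu' + 2 * s * lc (u ++ v) <= kappa].
Proof.
move=> wu hmu lu.
(* [c1] collects the bounded losses at the two large digits, [c2] also those of the filling. *)
pose c1 := s * ln 72 + s * ln 2 + 2 * ln 2 + 4 * s * ln 6 + `|kappa|.
pose c2 := kappa + ((size u)%:R * lam + l.+2%:R * (lam + 2 * s * ln 2)) + lam + c1.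
have d0 : 0 < lam - f * b by rewrite subr_gt0.
(* The time is n + 1; counted from 0, its two digits have the indices n and n + 1. *)
have [[|n]] := Psi_io (maxn (size u).+1 (Num.truncn (c2 / (lam - f * b))).+1).
  by rewrite leqNgt leq_max.
rewrite geq_max ltnS => /andP[un nc] Psin.
have nR : c2 <= n.+1%:R * (lam - f * b).
  rewrite -ler_pdivrMr//; apply: ltW; apply: lt_le_trans (truncnS_gt _) _.
  by rewrite ler_nat.
have [v [mu' [wv suv lv hv]]] := fill wu hmu lu un.
have wuv : word (u ++ v) by rewrite word_cat wu.
pose X := alpha * (n.+1%:R * b); pose Y := (1 - t0 * alpha) / t1 * (n.+1%:R * b).
have nb0 : 0 <= n.+1%:R * b by rewrite mulr_ge0// ltW.
have X0 : 0 <= X by rewrite mulr_ge0.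
have Y0 : 0 <= Y by rewrite mulr_ge0// divr_ge0 ?subr_ge0// ltW.
(* [XF] is the requirement of [big_step] at the first large digit. [YF] is that at the second, after
   the first has contributed (2 s - 1) X. *)
have XF : s * X <= f * (n.+1%:R * b) by rewrite /X mulrA ler_wpM2r.
have YF : (2 * s - 1) * X + s * Y <= f * (n.+1%:R * b).
  have -> : (2 * s - 1) * X + s * Y =
      ((2 * s - 1) * alpha + s * ((1 - t0 * alpha) / t1)) * (n.+1%:R * b).
    by rewrite /X /Y; ring.
  by rewrite ler_wpM2r.
have [MA MA0 /andP[XA XA']] := nat_near_exp X0.
have [MD MD0 /andP[YD YD']] := nat_near_exp Y0.
have l2 := @ln2_gt0 R; have l6 : 0 <= ln 6 :> R by rewrite ln_ge0// ler1n.
have l72 : 0 <= ln 72 :> R by rewrite ln_ge0// ler1n.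
(* The sign of 2 s - 1 is not known, so both bounds on the logarithm of the integer are used. *)
have mlog (x z : R) : 0 <= x -> x <= z <= x + ln 2 ->
    (2 * s - 1) * z <= (2 * s - 1) * x + ln 2.
  move=> x0 /andP[xz zx]; have [h|h] := lerP 0 (2 * s - 1).
    apply: le_trans (ler_wpM2l h zx) _; rewrite mulrDr lerD2l ger_pMl//.
    by have := s1; lra.
  by have := ler_wnM2l (ltW h) xz; lra.
have mA := mlog _ _ X0 (introT andP (conj XA XA')).
have mD := mlog _ _ Y0 (introT andP (conj YD YD')).
have kk : - `|kappa| <= kappa by rewrite lerNl -normrN ler_norm.
have sl2 : 0 <= s * ln 2 by rewrite mulr_ge0// ltW.
have sl6 : 0 <= s * ln 6 by rewrite mulr_ge0// ltW.
have sl72 : 0 <= s * ln 72 by rewrite mulr_ge0// ltW.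
have sXA : s * ln MA%:R <= s * X + s * ln 2 by rewrite -mulrDr ler_pM2l.
have sYD : s * ln MD%:R <= s * Y + s * ln 2 by rewrite -mulrDr ler_pM2l.
have sY1 : (2 * s - 1) * Y <= s * Y by rewrite ler_wpM2r//; have := s1; lra.
have hv' : mu' + 2 * s * lc (u ++ v) + f * (n.+1%:R * b) + c1 <= 0.
  move: hv nR; rewrite /c2 -[n.+1%:R]natr1; lra.
have n0 := normr_ge0 kappa; rewrite /c1 in hv'.
have [|a [aM la ha]] := big_step wuv MA0 _ lv; first by lra.
have wa : word [:: a] by rewrite /= (leq_trans MA0)//; case/andP: aM.
have wuva : word ((u ++ v) ++ [:: a]) by rewrite word_cat wuv.
have [|d [dM ld hd]] := big_step wuva MD0 _ la; first by lra.
have wd : word [:: d] by rewrite /= (leq_trans MD0)//; case/andP: dM.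
exists (v ++ [:: a; d]), (mu' - ln MA%:R - ln MD%:R), n.
have catE : u ++ v ++ [:: a; d] = ((u ++ v) ++ [:: a]) ++ [:: d] by rewrite -!catA.
rewrite catE; split=> //.
- by rewrite word_cat wv /= (andP wa).1 (andP wd).1.
- by rewrite size_cat size_cat suv /= !addn1.
- have sA : size ((u ++ v) ++ [:: a]) = n.+1 by rewrite size_cat suv addn1.
  rewrite !(nth_cat _ ((u ++ v) ++ _)) sA ltnSn ltnn subnn nth_cat suv ltnn subnn /=.
  have aR : 0 < a%:R :> R by rewrite ltr0n; case/andP: wa.
  have dR : 0 < d%:R :> R by rewrite ltr0n; case/andP: wd.
  apply: (le_trans Psin).
  rewrite -[a%:R]lnK ?posrE// -[d%:R]lnK ?posrE// -!expRM -expRD ler_expR.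
  have Xa : t0 * X <= t0 * ln a%:R.
    have aMR : MA%:R <= a%:R :> R by rewrite ler_nat; case/andP: aM.
    have mR : 0 < MA%:R :> R by rewrite ltr0n.
    apply: ler_wpM2l; first exact: ltW.
    by apply: (le_trans XA); rewrite ler_ln ?posrE.
  have Yd : t1 * Y <= t1 * ln d%:R.
    have dMR : MD%:R <= d%:R :> R by rewrite ler_nat; case/andP: dM.
    have mR : 0 < MD%:R :> R by rewrite ltr0n.
    apply: ler_wpM2l; first exact: ltW.
    by apply: (le_trans YD); rewrite ler_ln ?posrE.
  have XY : n.+1%:R * b = t0 * X + t1 * Y by rewrite /X /Y; field; rewrite gt_eqF.
  by rewrite XY; lra.
- by lra.
Qed.

(** If the cost were smaller, the empty word with mass e^kappa could start the descent, and
    iterating [stage] would lead to an uncovered point of the set. *)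
Lemma cover_lower_bound : E_t t0 t1 Psi `<=` \bigcup_i U i ->
  ((expR ((ln delta - 2 * ln 2) * s))%:E <= \sum_(0 <= i <oo) (c i)%:E)%E.
Proof.
move=> EU; rewrite leNgt; apply/negP => small.
pose good (p : seq nat * R) := [/\ word p.1, p.2 + 2 * s * lc p.1 <= kappa &
  (load p.1 < (expR p.2)%:E)%E].
pose node := {p | good p}.
pose next (p q : node) := exists n, [/\ exists v, (sval q).1 = (sval p).1 ++ v,
  size (sval q).1 = n.+2, (size (sval p).1 <= n)%N &
  Psi n.+1 <= (nth 0%N (sval q).1 n)%:R `^ t0 * (nth 0%N (sval q).1 n.+1)%:R `^ t1].
have next_ex (p : node) : exists q, next p q.
  case: p => -[u mu] [/= wu hmu lu].
  have [v [mu' [n [[wv un] sn Pn lv hv]]]] := stage wu hmu lu.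
  have hq : good (u ++ v, mu') by rewrite /good /= word_cat wu wv.
  by exists (exist _ (u ++ v, mu') hq), n; split=> //; exists v.
have [F hF] := choice next_ex.
have h0 : good ([::], kappa).
  split=> //=; first by rewrite /lc /cont ln1 mulr0 addr0.
  apply: le_lt_trans small; apply: lee_nneseries => [i _ _|i _].
    by case: ifP => // _; rewrite lee_fin ltW.
  by case: ifP => // _; rewrite lee_fin ltW.
pose nd k := iter k F (exist _ ([::], kappa) h0 : node).
pose u k := (sval (nd k)).1.
have uS k : next (nd k) (nd k.+1) := hF (nd k).
have u_word k : word (u k) by rewrite /u; case: (nd k) => p [].
have u_cat k j : exists v, u (k + j)%N = u k ++ v.
  elim: j => [|j [v vE]]; first by exists [::]; rewrite addn0 cats0.
  have [n [[w wE] _ _ _]] := uS (k + j)%N.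
  by exists (v ++ w); rewrite addnS catA -vE -wE.
have u_size k : (k <= size (u k))%N.
  elim: k => // k IH; have [n [_ sn kn _]] := uS k.
  by rewrite /u sn ltnS (leq_trans IH)// (leq_trans kn).
pose a i := nth 0%N (u i.+1) i.
have a_nth k i : (i < size (u k))%N -> nth 0%N (u k) i = a i.
  move=> ik; have [v1 e1] := u_cat k i.+1; have [v2 e2] := u_cat i.+1 k.
  rewrite addnC in e2; have := congr1 (fun w => nth 0%N w i) e1.
  by rewrite {1}e2 !nth_cat ik (u_size i.+1) => <-.
have uE k : u k = mkseq a (size (u k)).
  apply: (@eq_from_nth _ 0%N); first by rewrite size_mkseq.
  by move=> i ik; rewrite nth_mkseq// a_nth.
have a0 i : (0 < a i)%N by apply: (allP (u_word i.+1)); rewrite mem_nth// u_size.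
have [x [xi xa xc]] := infinite_cfrac (R := R) a0.
have [i _ Ux] : (\bigcup_i U i) x.
  apply: EU; split=> //; apply/infinite_natP => N.
  have [n [_ sn Nn Pn]] := uS N; exists n.+1.
    by rewrite (leq_trans (u_size N))// (leq_trans Nn).
  split=> //; have [_ ->] := digitE n xi; have [_ ->] := digitE n.+1 xi.
  rewrite !xa -!pmulrn; move: Pn; rewrite -/(u N.+1) in sn *.
  by rewrite !a_nth ?sn.
have ci k : c i <= expR (kappa - (k%:R - 1) * ln 2 * s).
  have hi : hit (u k) i by apply/asboolP; exists x; split=> //; rewrite uE.
  have : ((c i)%:E <= load (u k))%E.
    rewrite /load nneseries_esumT; last first.
      by move=> j; case: ifP => // _; rewrite lee_fin ltW.
    apply: le_trans (esum_ge_term (i := i) _ _) => //=; rewrite hi//.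
    by rewrite lee_fin ltW.
  have [_ hk lk] : [/\ word (u k), (sval (nd k)).2 + 2 * s * lc (u k) <= kappa &
    (load (u k) < (expR (sval (nd k)).2)%:E)%E] by rewrite /u; case: (nd k).
  move=> /le_lt_trans /(_ lk); rewrite lte_fin => /ltW/le_trans; apply.
  rewrite ler_expR.
  have h := lc_ge_linear (R := R) (u_word k).
  have h2 : (k%:R - 1) * ln 2 <= 2 * lc (u k) :> R.
    by apply: le_trans h; rewrite ler_pM2r ?ln2_gt0// lerD2r ler_nat.
  have := ler_wpM2r (ltW s0) h2; lra.
have d0 : 0 < c i * expR (- (kappa + ln 2 * s)) / 2.
  by rewrite divr_gt0// mulr_gt0// expR_gt0.
have [k /(_ k (leqnn _)) hk] := expR_small (mulr_gt0 ln2_gt0 s0) d0.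
have h := ci k.
rewrite (_ : kappa - _ = (kappa + ln 2 * s) + - (k%:R * (ln 2 * s))) in h;
  last by ring.
rewrite expRD in h.
have := le_trans h (ler_wpM2l (expR_ge0 _) hk).
rewrite mulrA mulrCA -expRD subrr expR0 mulr1 ler_pdivlMr//.
by have := c_gt0 i; lra.
Qed.

End LowerBound.

(** * The dimension formula *)

Section Dimension.
Context {R : realType}.
Variables (t0 t1 B : R) (Psi : nat -> R).
Hypotheses (ht0 : 0 < t0) (ht1 : 0 < t1) (hB1 : 1 < B).
Hypothesis hPsi : forall n : nat, (0 < n)%N -> 1 <= Psi n.
Hypothesis hB : limn_einf (fun n : nat => (ln (Psi n) / n%:R)%:E) = (ln B)%:E.
Implicit Types s : R.

Let lnB : 0 < ln B. Proof. by rewrite ln_gt0. Qed.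

Let Psi_ge b : b < ln B ->
  exists N, forall n, (N <= n)%N -> expR (n%:R * b) <= Psi n.
Proof.
rewrite -lte_fin -hB => /lt_limn_einf[N hN]; exists N.+1 => n Nn.
have n0 : (0 < n)%N by rewrite (leq_trans _ Nn).
have P0 : 0 < Psi n := lt_le_trans ltr01 (hPsi n0).
have := hN n (ltnW Nn); rewrite lte_fin ltr_pdivlMr ?ltr0n// mulrC => /ltW h.
by rewrite -[Psi n]lnK ?posrE// ler_expR.
Qed.

Let Psi_le b : ln B < b ->
  forall N, exists2 n, (N <= n)%N & Psi n <= expR (n%:R * b).
Proof.
rewrite -lte_fin -hB => /limn_einf_lt hN N; have [n Nn] := hN N.+1.
have n0 : (0 < n)%N by rewrite (leq_trans _ Nn).
have P0 : 0 < Psi n := lt_le_trans ltr01 (hPsi n0).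
rewrite lte_fin ltr_pdivrMr ?ltr0n// mulrC => /ltW h; exists n; first exact: ltnW.
by rewrite -[leLHS]lnK ?posrE// ler_expR.
Qed.

Let measure0 s P : 0 < s <= 1 -> growth s P -> P < f_t t0 t1 s * ln B ->
  hausdorff_measure s (E_t t0 t1 Psi) = 0%E.
Proof.
move=> hs gP PB; have [f0 _ _ _] := f_tP ht0 ht1 hs.
have [p Pp pB] : exists2 p, P < f_t t0 t1 s * p & p < ln B.
  exists ((P / f_t t0 t1 s + ln B) / 2); have : P / f_t t0 t1 s < ln B.
  - by rewrite ltr_pdivrMr// mulrC.
  - by move=> h; rewrite mulrC -ltr_pdivrMr//; move: (P / _) h => x h; lra.
  - by rewrite ltr_pdivrMr// mulrC.
  - by move: (P / _) => x h; lra.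
(* P may be negative, so [p] alone need not be positive. *)
pose b := Num.max (ln B / 2) p.
have b0 : 0 < b by rewrite lt_max divr_gt0.
have bB : b < ln B by rewrite gt_max pB andbT; have := lnB; lra.
have Pb : P < f_t t0 t1 s * b by rewrite (lt_le_trans Pp)// ler_pM2l// le_max lexx orbT.
exact: (hausdorff_upper ht0 ht1 b0 hs gP Pb (Psi_ge bB)).
Qed.

(** For s < 1, passing to s' > s makes the inequality strict, because P decreases strictly and f
    does not decrease; so the measure vanishes at s' arbitrarily close to s. For s >= 1 the bound by
    1 suffices. *)
Let dim_le s P : 0 <= s -> growth s P -> P <= f_t t0 t1 s * ln B ->
  (hausdorff_dim (E_t t0 t1 Psi) <= s%:E)%E.
Proof.
move=> s0 gP PB.
have dim1 : (hausdorff_dim (E_t t0 t1 Psi) <= 1%:E)%E.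
  have [P1 gP1 P10] := @growth1 R; apply: ereal_inf_lbound; exists 1 => //; split=> //.
  have s1 : 0 < (1 : R) <= 1 by rewrite ltr01 lexx.
  have [f0 _ _ _] := f_tP ht0 ht1 s1.
  by apply: (measure0 s1 gP1); rewrite (le_lt_trans P10)// mulr_gt0.
have [s1|s1] := lerP 1 s; first by rewrite (le_trans dim1)// lee_fin.
apply/lee_addgt0Pr => e e0; pose s' := Num.min 1 (s + e).
have ss' : s < s' by rewrite lt_min s1 ltrDl.
have s'1 : s' <= 1 by rewrite ge_min lexx.
apply: (@le_trans _ _ s'%:E); last by rewrite -EFinD lee_fin ge_min lexx orbT.
have s0s' : 0 <= s <= s' by rewrite s0 ltW.
have [P' gP' P'P] := growth_decr s0s' gP.
apply: ereal_inf_lbound; exists s' => //; split; first by rewrite (le_trans s0)// ltW.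
apply: (measure0 _ gP'); first by rewrite (le_lt_trans s0 ss').
apply: (le_lt_trans P'P).
have h1 : 0 < (s' - s) * ln 2 by rewrite mulr_gt0 ?subr_gt0 ?ln2_gt0.
have h2 : f_t t0 t1 s * ln B <= f_t t0 t1 s' * ln B by rewrite ler_pM2r// f_t_le.
lra.
Qed.

(* [alpha = f(s) / s] if the first term of the maximum in [f_t] is the larger
   one, and [alpha = 0] otherwise. *)
Let alpha_exists s : 0 < s <= 1 -> exists alpha,
  [/\ 0 <= alpha, t0 * alpha <= 1, s * alpha <= f_t t0 t1 s &
    (2 * s - 1) * alpha + s * ((1 - t0 * alpha) / t1) <= f_t t0 t1 s].
Proof.
move=> hs; have [f0 f1 fD [fE|fE]] := f_tP ht0 ht1 hs; have /andP[s0 s1] := hs.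
  exists 0; rewrite !mulr0 subr0 add0r mul1r; split=> //; first exact: ltW.
  suff -> : f_t t0 t1 s = s / t1 by [].
  by rewrite -[in RHS]fE mulfK ?gt_eqF.
have D0 : 0 < t0 * s + t1 * (1 - s).
  by rewrite ltr_wpDr ?mulr_gt0// mulr_ge0 ?subr_ge0// ltW.
exists (s / (t0 * s + t1 * (1 - s))); set D := t0 * s + t1 * (1 - s) in D0 fE *.
have -> : f_t t0 t1 s = s ^+ 2 / D by rewrite -fE mulfK ?gt_eqF.
split.
- by rewrite divr_ge0// ltW.
- rewrite mulrA ler_pdivrMr// mul1r /D lerDl mulr_ge0 ?subr_ge0//; exact: ltW.
- by rewrite expr2 mulrA.
- have -> : 1 - t0 * (s / D) = t1 * (1 - s) / D by rewrite /D; field; rewrite gt_eqF.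
  suff -> : (2 * s - 1) * (s / D) + s * (t1 * (1 - s) / D / t1) = s ^+ 2 / D by [].
  by field; rewrite !gt_eqF.
Qed.

(** With lam halfway between f(s) ln B and P, the factor e^(l (P - lam)) outgrows all constants; if
    there is no growth rate, the first word sum is already infinite. *)
Let big_word_sum s : 0 <= s ->
  (forall P, growth s P -> f_t t0 t1 s * ln B < P) ->
  exists2 lam, f_t t0 t1 s * ln B < lam &
    exists l, ((expR (6 * s * ln 2 + l.+2%:R * lam))%:E < word_sum s l)%E.
Proof.
move=> s0 hP; have [fin1|] := ltP (word_sum s 1) +oo%E; last first.
  rewrite leye_eq => /eqP inf1; exists (f_t t0 t1 s * ln B + 1); first by rewrite ltrDl.
  by exists 1%N; rewrite inf1 ltey.
have [P gP] := growth_exists s0 fin1; have PB := hP P gP.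
pose lam := (f_t t0 t1 s * ln B + P) / 2.
exists lam; first by rewrite /lam; lra.
apply: contrapT => h.
have : P <= lam; last by rewrite /lam; lra.
apply: (@le_of_linear _ _ _ (6 * s * ln 2 + 2 * lam)) => n.
rewrite leNgt; apply/negP => nP; apply: h; exists n.
have [g _] := gP n; apply: lt_le_trans g; rewrite lte_fin ltr_expR.
by move: nP; rewrite -[n.+2%:R]natr1 -[n.+1%:R]natr1; lra.
Qed.

Let finite_word_family s l (z : R) : (z%:E < word_sum s l)%E ->
  exists W, [/\ uniq W, forall w, w \in W -> words l w & z <= \sum_(w <- W) wt s w].
Proof.
move=> /ereal_sup_gt[_ [X [finX Xw] <-]]; rewrite fsbig_finite//= sumEFin lte_fin => h.
exists (finmap.enum_fset (fset_set X)); split; [exact: finmap.fset_uniq| |exact: ltW h].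
by move=> w; rewrite in_fset_set// inE => /Xw.
Qed.

Let measure_neq0 s s' : 0 <= s' <= s -> 0 < s < 1 ->
  (forall P, growth s P -> f_t t0 t1 s * ln B < P) ->
  hausdorff_measure s' (E_t t0 t1 Psi) <> 0%E.
Proof.
move=> /andP[s'0 s's] hs hP H0; have /andP[s0 s1] := hs.
have hs' : 0 < s <= 1 by rewrite s0 ltW.
have [f0 _ _ _] := f_tP ht0 ht1 hs'.
have [lam hlam [l hl]] := big_word_sum (ltW s0) hP.
have lam0 : 0 < lam by apply: lt_trans hlam; rewrite mulr_gt0.
have [W [W_uniq W_words W_sum]] := finite_word_family hl.
have [d d0 W_gap] := words_family_gap (R := R) W_words.
have [alpha [a0 a1 a2 a3]] := alpha_exists hs'.
pose b := (ln B + lam / f_t t0 t1 s) / 2.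
have Bl : ln B < lam / f_t t0 t1 s by rewrite ltr_pdivlMr// mulrC.
have bB : ln B < b by rewrite /b; lra.
have b0 : 0 < b := lt_trans lnB bB.
have bl : f_t t0 t1 s * b < lam by rewrite mulrC -ltr_pdivlMr// /b; lra.
(* Half of the bound of [cover_lower_bound] is for the diameters, half for the summands that make
   every [c i] positive. *)
pose e := expR ((ln d - 2 * ln 2) * s) / 2.
have e0 : 0 < e by rewrite divr_gt0// expR_gt0.
have : (hausdorff_content s' 1 (E_t t0 t1 Psi) < e%:E)%E.
  have : (hausdorff_content s' 1 (E_t t0 t1 Psi) <=
      hausdorff_measure s' (E_t t0 t1 Psi))%E.
    by apply: ereal_sup_ubound; exists 1 => //=.
  by rewrite H0 => /le_lt_trans; apply; rewrite lte_fin.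
move=> /ereal_inf_lt[_ [U [EU U1] <-] Ue].
have U_fin i : diam_pow s' (U i) \is a fin_num.
  rewrite ge0_fin_numE ?diam_pow_ge0//.
  by apply: le_lt_trans (diam_pow_le s'0 (U1 i) ler01) _; rewrite ltey.
pose c i := fine (diam_pow s' (U i)) + e / (2 ^ i.+1)%:R.
have cE i : (c i)%:E = (diam_pow s' (U i) + (e / (2 ^ i.+1)%:R)%:E)%E.
  by rewrite /c EFinD fineK.
have c_gt0 i : 0 < c i.
  by rewrite ltr_wpDl ?fine_ge0 ?diam_pow_ge0// divr_gt0// ltr0n expn_gt0.
have c_dist i x y : U i x -> U i y -> `|x - y| `^ s <= c i.
  move=> Ux Uy; have [->|xy] := eqVneq x y.
    by rewrite subrr normr0 powR0 ?gt_eqF// ltW.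
  have xy0 : 0 < `|x - y| by rewrite normr_gt0 subr_eq0.
  have xyd := diam_ge Ux Uy.
  have xy1 : `|x - y| <= 1 by rewrite -lee_fin (le_trans xyd).
  apply: (@le_trans _ _ (`|x - y| `^ s')); first by rewrite ger_powR ?xy0.
  apply: (@le_trans _ _ (fine (diam_pow s' (U i)))); last first.
    by rewrite lerDl divr_ge0// ltW.
  rewrite -lee_fin fineK// /diam_pow ifF; last by apply/negbTE/set0P; exists x.
  by rewrite -poweR_EFin gt0_ler_poweR// in_itv/= leey andbT ?(diam_ge0 Ux)// lee_fin.
have := cover_lower_bound hs lam0 d0 W_uniq W_words W_sum W_gap c_gt0 c_dist
  ht0 ht1 b0 bl a0 a1 a2 a3 (Psi_le bB) EU.
rewrite leNgt => /negP; apply.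
under eq_eseriesr => i _ do rewrite cE.
apply: (le_lt_trans (epsilon_trick _ _ (ltW e0))).
  by move=> i; exact: diam_pow_ge0.
rewrite (_ : expR _ = e + e); last by rewrite /e; field.
by rewrite EFinD lteD2rE.
Qed.

Lemma hausdorff_dim_E_t : hausdorff_dim (E_t t0 t1 Psi) =
  ereal_inf [set s%:E | s in [set s : R | 0 <= s /\
    (pressure (potential s (f_t t0 t1 s * ln B)) <= 0)%E]].
Proof.
apply/eqP; rewrite eq_le; apply/andP; split.
  apply: le_ereal_inf_tmp => _ [s [s0 /(pressure_le0 _ s0)[P gP PB]] <-].
  exact: dim_le s0 gP PB.
apply: le_ereal_inf_tmp => _ [s [s0 H0] <-]; rewrite leNgt; apply/negP.
set A := [set _ | _ in _] => sA.
have inf1 : (ereal_inf A <= 1%:E)%E.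
  have [P gP P0] := @growth1 R; apply: ereal_inf_lbound; exists 1 => //; split=> //.
  apply/(pressure_le0 _ ler01); exists P => //.
  have s1 : 0 < (1 : R) <= 1 by rewrite ltr01 lexx.
  have [f0 _ _ _] := f_tP ht0 ht1 s1.
  by rewrite (le_trans P0)// ltW// mulr_gt0.
case E : (ereal_inf A) sA inf1 => [r| |]//; rewrite lte_fin lee_fin => sr r1.
(* Strictly below the infimum every growth rate exceeds f(s') ln B, and r <= 1 gives s' < 1, so
   [measure_neq0] contradicts [H0]. *)
pose s' := (s + r) / 2.
have ss' : s < s' by rewrite /s'; lra.
have s'r : s' < r by rewrite /s'; lra.
have s'0 : 0 < s' := le_lt_trans s0 ss'.
apply: (@measure_neq0 s' s _ _ _ H0); first by rewrite s0 ltW.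
  by rewrite s'0 (lt_le_trans s'r).
move=> P gP; rewrite ltNge; apply/negP => PB.
have : (ereal_inf A <= s'%:E)%E.
  apply: ereal_inf_lbound; exists s' => //; split; first exact: ltW.
  by apply/(pressure_le0 _ (ltW s'0)); exists P.
by rewrite E lee_fin leNgt s'r.
Qed.

End Dimension.

Theorem theorem1p6 (R : realType) (t0 t1 : R) (Psi : nat -> R) (B : R)
    (ht0 : 0 < t0) (ht1 : 0 < t1)
    (hPsi : forall n : nat, (0 < n)%N -> 1 <= Psi n)
    (hB1 : 1 < B)
    (hB : limn_einf (fun n : nat => (ln (Psi n) / n%:R)%:E) = (ln B)%:E) :
  hausdorff_dim (E_t t0 t1 Psi) =
  ereal_inf [set s%:E | s in [set s : R | 0 <= s /\
    (pressure (fun x : R =>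
       (- s * ln `|gauss^`()%classic x| - f_t t0 t1 s * ln B)%R) <= 0)%E]].
Proof. exact: hausdorff_dim_E_t. Qed.
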